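(* Let $d\geqslant 1$, let $\sigma\in\mathbb R^{d\times d}$ and let $b\in\mathcal C^2(\mathbb R^d,\mathbb R^d)$ have bounded second-order derivatives and be such that there exists $L>0$ with $(x-y)\cdot(b(x)-b(y))\leqslant L|x-y|^2$ for all $x,y\in\mathbb R^d$. Let $X$ denote solutions of $dX_t=b(X_t)\,dt+\sigma\,dB_t$. Assume that the process is controllable, in the sense that for all $x,y\in\mathbb R^d$ and $t,\varepsilon>0$, $\mathbb P_x(|X_t-y|\leqslant\varepsilon)>0$. Assume furthermore either one of these two conditions: (1) $\nabla b$ is bounded; (2) for any $x,y\in\mathbb R^d$, there exists $R>0$ such that for all $t,\varepsilon>0$, \[\mathbb P_x\left(|X_t-y|\leqslant\varepsilon\ \text{ and }\ |X_s|\leqslant R\ \ \forall s\in[0,t]\right)>0.\] Then, for any $t\geqslant 0$ and $x\in\mathbb R^d$, \[\lim_{p\to\infty}\ \sup_{v\in\mathbb S^{d-1}}\left[\mathbb E_x\left(|\Phi_t^Xv|^p\right)\right]^{1/p}\geqslant\overline{\kappa}_\infty(t).\] In particular, $\lim_{p\to\infty}\kappa_p(t)\geqslant\overline{\kappa}_\infty(t)$.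
   Context: $|\cdot|$ is the Euclidean norm on $\mathbb R^d$ and the associated operator norm on matrices, $\mathbb S^{d-1}$ the unit sphere of $\mathbb R^d$, and $\nabla b$ the Jacobian matrix of $b$. The matrix $\sigma$ is constant and may be singular; $B$ is a standard Brownian motion in $\mathbb R^d$; $\mathbb P_x,\mathbb E_x$ correspond to $X_0=x$. For a solution $X$ of the SDE, $\Phi_t^X$ is the random $d\times d$ matrix such that $\Phi_t^Xv=V_t$ where $(V_s)_{s\geqslant 0}$ solves $dV_t=\nabla b(X_t)V_t\,dt$, $V_0=v$, and for $p\geqslant 1$, $\kappa_p(t)=\sup_{x\in\mathbb R^d,\,v\in\mathbb S^{d-1}}\left(\mathbb E_x(|\Phi_t^Xv|^p)\right)^{1/p}$. For a continuous path $\gamma$, $\Phi_t^\gamma$ is the matrix solution of $\partial_t\Phi_t^\gamma=\nabla b(\gamma(t))\Phi_t^\gamma$, $\Phi_0^\gamma=\mathrm{Id}$. The set of admissible paths at time $T$ is \[\mathcal A(T)=\left\{\gamma\in\mathcal C([0,T],\mathbb R^d):\ \forall\varepsilon>0,\ \mathbb P_{\gamma(0)}\left(|X_t-\gamma(t)|\leqslant\varepsilon\ \ \forall t\in[0,T]\right)>0\right\},\] and $\overline{\kappa}_\infty(T)=\sup\{|\Phi_T^\gamma|:\ \gamma\in\mathcal A(T)\}$. *)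

(* Defs.v *)
From HB Require Import structures.
From mathcomp Require Export all_boot all_order all_algebra.
From mathcomp Require Export all_classical all_reals all_analysis.
Export Order.TTheory GRing.Theory Num.Theory.
Export numFieldNormedType.Exports.

Set Implicit Arguments.
Unset Strict Implicit.
Unset Printing Implicit Defensive.

#[global] Open Scope classical_set_scope.
#[global] Open Scope ring_scope.

Section Euclidean.
Context {R : realType} {n : nat}.
Implicit Types (u v : 'cV[R]_n) (M : 'M[R]_n).

Definition dot u v : R := \sum_i u i 0 * v i 0.
(* The norm `|v| of the library is the sup norm. *)
Definition enorm v : R := Num.sqrt (dot v v).
Definition sphere : set 'cV[R]_n := [set v | enorm v = 1].
Definition opnorm M : R := sup [set enorm (M *m v) | v in sphere].

End Euclidean.

Section Calculus.
Context {R : realType} {n : nat}.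
Implicit Types (f : 'cV[R]_n -> R) (b : 'cV[R]_n -> 'cV[R]_n).

Definition partial (j : 'I_n) f : 'cV[R]_n -> R := 'D_(delta_mx j 0) f.

Definition coord b (i : 'I_n) : 'cV[R]_n -> R := fun x => b x i 0.

(* entry (i, j) is the partial derivative of b_i with respect to x_j *)
Definition jac b (x : 'cV[R]_n) : 'M[R]_n :=
  \matrix_(i, j) partial j (coord b i) x.

Definition C1 f := forall j,
  (forall x, derivable f x (delta_mx j 0)) /\ continuous (partial j f).

Definition C2 f := C1 f /\ forall j, C1 (partial j f).

(* V' = jac b (gamma) V on [0, T] with V(0) = V0; continuity on [0, T] and the
   equation on ]0, T[ force the one-sided derivatives at 0 and T when gamma is
   continuous. *)
Definition variational b (gamma : R -> 'cV[R]_n) (T : R) {k : nat}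
    (V0 : 'M[R]_(n, k)) (V : R -> 'M[R]_(n, k)) :=
  [/\ V 0 = V0, {within `[0, T], continuous V} &
      forall t : R, 0 < t -> t < T -> is_derive t 1 V (jac b (gamma t) *m V t)].

End Calculus.

Section Processes.
Context {R : realType} {d : measure_display} {Omega : measurableType d}.

Definition random_process {m k : nat} (Y : R -> Omega -> 'M[R]_(m, k)) :=
  forall t : R, 0 <= t -> forall i j, measurable_fun setT (fun w => Y t w i j).

(* Continuity is required for every w, so that events constraining a whole
   trajectory are measurable without completing the sigma-algebra. *)
Definition continuous_paths {m k : nat} (Y : R -> Omega -> 'M[R]_(m, k)) :=
  forall w, {within `[0, +oo[, continuous (fun t => Y t w)}.

(* The product rule over all measurable sets contains the one over every
   subfamily: take A i = setT outside of it. *)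
Definition mutually_independent (P : probability Omega R) (I : finType)
    (Y : I -> Omega -> R) :=
  forall A : I -> set R, (forall i, measurable (A i)) ->
  P [set w | forall i, A i (Y i w)] = (\prod_i P (Y i @^-1` A i))%E.

(* Standard Brownian motion in R^n. The coordinates of the successive
   increments are asked to be jointly independent: this is independence of the
   increments together with independence of the n coordinates. Times are
   strictly ordered because normal_prob m 0 is not a Dirac mass. *)
Definition brownian_motion (P : probability Omega R) {n : nat}
    (B : R -> Omega -> 'cV[R]_n) :=
  [/\ random_process B, continuous_paths B,
      {ae P, forall w, B 0 w = 0},
      forall s t : R, 0 <= s -> s < t -> forall i (A : set R), measurable A ->
        P [set w | A ((B t w - B s w) i 0)] =
        normal_prob 0 (Num.sqrt (t - s)) A &
      forall (k : nat) (t : nat -> R), 0 <= t 0%N ->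
        (forall l, (l < k)%N -> t l < t l.+1) ->
        mutually_independent P (fun li : 'I_k * 'I_n =>
          fun w => (B (t li.1.+1) w - B (t li.1) w) li.2 0)].

(* dX = b(X) dt + sigma dB, X_0 = x. Since sigma is constant, the stochastic
   integral of sigma is sigma B. *)
Definition sde_solution (P : probability Omega R) {n : nat}
    (b : 'cV[R]_n -> 'cV[R]_n) (sigma : 'M[R]_n) (B : R -> Omega -> 'cV[R]_n)
    (x : 'cV[R]_n) (X : R -> Omega -> 'cV[R]_n) :=
  [/\ random_process X, continuous_paths X &
      {ae P, forall w, forall t : R, 0 <= t ->
        X t w = x
          + \col_i (\int[lebesgue_measure]_(s in `[0, t]) b (X s w) i 0)%R
          + sigma *m B t w}].

(* The random matrices with Phi_t v = V_t, where V' = jac b (X) V, V_0 = v. *)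
Definition tangent_flow {n : nat} (b : 'cV[R]_n -> 'cV[R]_n)
    (X : R -> Omega -> 'cV[R]_n) (Phi : R -> Omega -> 'M[R]_n) :=
  random_process Phi /\
  forall w (v : 'cV[R]_n) (T : R), 0 <= T ->
    variational b (X ^~ w) T v (fun t => Phi t w *m v).

Definition moment (P : probability Omega R) {n : nat}
    (Phi : R -> Omega -> 'M[R]_n) (t p : R) (v : 'cV[R]_n) : \bar R :=
  ('E_P[fun w => (enorm (Phi t w *m v) `^ p)%R] `^ p^-1)%E.

(* From here on, P x is the law under which X_0 = x. *)
Context {n : nat} (P : 'cV[R]_n -> probability Omega R).

Definition kappa (Phi : R -> Omega -> 'M[R]_n) (p t : R) : \bar R :=
  ereal_sup [set moment (P xv.1) Phi t p xv.2 | xv in setT `*` sphere].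

Definition admissible (X : R -> Omega -> 'cV[R]_n) (T : R)
    (gamma : R -> 'cV[R]_n) :=
  {within `[0, T], continuous gamma} /\
  forall eps : R, 0 < eps ->
    (0 < P (gamma 0%R) [set w | forall t : R, 0 <= t -> t <= T ->
                                enorm (X t w - gamma t) <= eps]%R)%E.

Definition kappa_infty (b : 'cV[R]_n -> 'cV[R]_n) (X : R -> Omega -> 'cV[R]_n)
    (T : R) : \bar R :=
  ereal_sup [set e | exists (gamma : R -> 'cV[R]_n) (Phi : R -> 'M[R]_n),
    [/\ admissible X T gamma, variational b gamma T 1%:M Phi &
        e = (opnorm (Phi T))%:E]].

End Processes.

(* Main.v *)
From HB Require Import structures.
Require Import Defs.
From mathcomp Require Import ring lra measurable_realfun.

(** The [p]-th mean of [|Phi_t v|] tends, as [p] grows, to its essential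
    supremum. It is therefore enough that, whatever the starting point [x], the
    quantity [|Phi_t v|] comes as close as desired to [|Phi_t^gamma v|] with
    positive probability ([flow_large_with_positive_probability]; the passage to
    the limit is [lp_mean_flow_limit]).

    To see this, fix an admissible path [gamma]. Issued from [x], the process can
    reach the vicinity of [gamma 0] in a time [del] as short as desired, while
    the Jacobian of the drift along its trajectory stays bounded by a constant
    independent of [del]: this is where controllability and the alternative
    between the two conditions enter ([reach_with_bounded_jacobian]). During that
    time the tangent flow stays near the identity ([flow_short]). Afterwards the
    process can follow [gamma] for the remaining time [t - del], and by Gronwall's
    lemma its tangent flow is then close to the one along [gamma]
    ([flow_close]).

    Chaining the two stages calls for a Markov property, which is obtained here
    by expressing both stages in terms of the Brownian motion. As [sigma] is
    constant, [X - sigma B] is continuously differentiable, and the equation can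
    be read trajectory by trajectory ([driven]). Two solutions that are uniformly
    close have uniformly close noises ([noise_close]); conversely, thanks to the
    one-sided Lipschitz bound, uniformly close noises give uniformly close
    solutions ([path_close]). Admissibility of [gamma] thus says that [sigma B]
    stays in any tube around a deterministic path with positive probability
    ([admissible_noise]). Likewise, the event of reaching [gamma 0] can be
    replaced by a tube around [sigma B w0], where [w0] is an outcome in that
    event all of whose tubes have positive probability; such outcomes form a set
    of full measure, because the space of continuous paths is separable
    ([ae_tube_gt0]).

    It remains to combine a tube for the noise on [[0, del]] with a tube for its
    increments after [del]. On a finite grid of times both are events on
    increments of [B], whose joint law is a product that does not depend on the
    starting point ([increments_indep]); refining the grid, the product formula
    passes to the limit as a lower bound ([tube_concat]). *)

Set Implicit Arguments.
Unset Strict Implicit.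
Unset Printing Implicit Defensive.

(** * Euclidean norm and operator norm *)

Section EuclideanTheory.
Context {R : realType} {n : nat}.
Implicit Types (u v w : 'cV[R]_n) (M : 'M[R]_n).

Lemma dotC u v : dot u v = dot v u.
Proof. by apply: eq_bigr => i _; rewrite mulrC. Qed.

Lemma dotDl u v w : dot (u + v) w = dot u w + dot v w.
Proof. by rewrite -big_split; apply: eq_bigr => i _; rewrite mxE mulrDl. Qed.

Lemma dotZl (a : R) u v : dot (a *: u) v = a * dot u v.
Proof. by rewrite mulr_sumr; apply: eq_bigr => i _; rewrite mxE mulrA. Qed.

Lemma dotNl u v : dot (- u) v = - dot u v.
Proof. by rewrite -scaleN1r dotZl mulN1r. Qed.

Lemma dotDr u v w : dot u (v + w) = dot u v + dot u w.
Proof. by rewrite dotC dotDl (dotC v) (dotC w). Qed.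

Lemma dotZr (a : R) u v : dot u (a *: v) = a * dot u v.
Proof. by rewrite dotC dotZl dotC. Qed.

Lemma dotNr u v : dot u (- v) = - dot u v.
Proof. by rewrite dotC dotNl dotC. Qed.

Lemma dot_ge0 v : 0 <= dot v v.
Proof. by apply: sumr_ge0 => i _; rewrite -expr2 sqr_ge0. Qed.

Lemma enorm_ge0 v : 0 <= enorm v.
Proof. exact: sqrtr_ge0. Qed.

Lemma enorm_sqr v : enorm v ^+ 2 = dot v v.
Proof. by rewrite sqr_sqrtr // dot_ge0. Qed.

Lemma enormN v : enorm (- v) = enorm v.
Proof. by rewrite /enorm dotNl dotNr opprK. Qed.

Lemma enormB u v : enorm (u - v) = enorm (v - u).
Proof. by rewrite -enormN opprB. Qed.

Lemma enorm0 : enorm (0 : 'cV[R]_n) = 0.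
Proof. by rewrite /enorm -(scale0r 0) dotZl mul0r sqrtr0. Qed.

Lemma dot_le u v : dot u v <= enorm u * enorm v.
Proof.
have [u0|u0] := eqVneq (enorm u) 0.
  have /eqP : dot u u = 0 by rewrite -enorm_sqr u0 expr0n.
  rewrite psumr_eq0 => [/allP z|i _]; last by rewrite -expr2 sqr_ge0.
  rewrite u0 mul0r /dot big1 // => i _.
  have := z i (mem_index_enum i); rewrite /= mulf_eq0 orbb => /eqP ->.
  by rewrite mul0r.
have [v0|v0] := eqVneq (enorm v) 0.
  have /eqP : dot v v = 0 by rewrite -enorm_sqr v0 expr0n.
  rewrite psumr_eq0 => [/allP z|i _]; last by rewrite -expr2 sqr_ge0.
  rewrite v0 mulr0 /dot big1 // => i _.
  have := z i (mem_index_enum i); rewrite /= mulf_eq0 orbb => /eqP ->.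
  by rewrite mulr0.
have up : 0 < enorm u by rewrite lt_def u0 enorm_ge0.
have vp : 0 < enorm v by rewrite lt_def v0 enorm_ge0.
(* |u| |v| (|u| |v| - u.v) is half the squared norm of |v| u - |u| v *)
have := dot_ge0 (enorm v *: u - enorm u *: v).
rewrite dotDl !dotDr !dotNl !dotNr !dotZl !dotZr -!enorm_sqr (dotC v u).
move=> h; rewrite -subr_ge0 -(pmulr_rge0 _ (mulr_gt0 up vp)).
rewrite -(pmulr_rge0 _ (ltr0n R 2)); apply: le_trans h _.
by rewrite le_eqVlt; apply/orP; left; apply/eqP; ring.
Qed.

Lemma ler_enormD u v : enorm (u + v) <= enorm u + enorm v.
Proof.
rewrite -ler_sqr ?nnegrE ?addr_ge0 ?enorm_ge0 // enorm_sqr.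
rewrite dotDl !dotDr (dotC v u) -!enorm_sqr.
have := dot_le u v; nra.
Qed.

Lemma ler_enorm_add_dist u v : enorm u <= enorm v + enorm (u - v).
Proof. by rewrite -{1}(subrKC v u); apply: ler_enormD. Qed.

Lemma enormZ (a : R) v : enorm (a *: v) = `|a| * enorm v.
Proof.
by rewrite /enorm dotZl dotZr mulrA -expr2 sqrtrM ?sqr_ge0 // sqrtr_sqr.
Qed.

Lemma coord_le_enorm v i : `|v i 0| <= enorm v.
Proof.
rewrite -ler_sqr ?nnegrE ?enorm_ge0 // enorm_sqr real_normK ?num_real //.
rewrite /dot (bigD1 i) //= -expr2 lerDl; apply: sumr_ge0 => j _.
by rewrite -expr2 sqr_ge0.
Qed.

(** The factor [n] is not optimal ([sqrt n] would do), but only the equivalence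
    of the norms matters. *)
Lemma enorm_le_coord v (c : R) : 0 <= c ->
  (forall i, `|v i 0| <= c) -> enorm v <= n%:R * c.
Proof.
move=> c0 vc; rewrite -ler_sqr ?nnegrE ?enorm_ge0 ?mulr_ge0 // enorm_sqr.
apply: (@le_trans _ _ (\sum_(i < n) c ^+ 2)).
  apply: ler_sum => i _; rewrite -expr2 -real_normK ?num_real //.
  by rewrite ler_sqr ?nnegrE.
rewrite sumr_const card_ord exprMn -[leLHS]mulr_natl.
apply: ler_wpM2r; rewrite ?sqr_ge0 // -natrX ler_nat.
by case: (n) => // k; rewrite leq_pmulr.
Qed.

Lemma enorm_mulmx_le_entry M v (c : R) : 0 <= c ->
  (forall i j, `|M i j| <= c) -> enorm (M *m v) <= n%:R * (n%:R * c) * enorm v.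
Proof.
move=> c0 Mc; rewrite -mulrA; apply: enorm_le_coord => [|i].
  by rewrite !mulr_ge0 ?enorm_ge0.
rewrite mxE; apply: le_trans (ler_norm_sum _ _ _) _.
apply: (@le_trans _ _ (\sum_(j < n) c * enorm v)).
  apply: ler_sum => j _; rewrite normrM ler_pM //; exact: coord_le_enorm.
by rewrite sumr_const card_ord -[leLHS]mulr_natl mulrA.
Qed.

Lemma enorm_mulmx_bounded M :
  exists2 K : R, 0 <= K & forall v, enorm (M *m v) <= K * enorm v.
Proof.
pose c : R := \sum_i \sum_j `|M i j|.
have c0 : 0 <= c by apply: sumr_ge0 => i _; apply: sumr_ge0.
exists (n%:R * (n%:R * c)) => [|v]; first by rewrite !mulr_ge0.
apply: enorm_mulmx_le_entry => // i j; rewrite /c (bigD1 i) //= (bigD1 j) //=.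
by rewrite -addrA lerDl addr_ge0 ?sumr_ge0 // => k _; apply: sumr_ge0.
Qed.

Lemma has_sup_opnorm M : (0 < n)%N ->
  has_sup [set enorm (M *m v) | v in sphere].
Proof.
move=> hn; split.
  pose e : 'cV[R]_n := delta_mx (Ordinal hn) 0.
  exists (enorm (M *m e)); exists e => //.
  rewrite /sphere /= /enorm /dot (bigD1 (Ordinal hn)) //= big1 => [|i ne].
    by rewrite /e !mxE !eqxx mulr1 addr0 sqrtr1.
  by rewrite /e !mxE (negbTE ne) mul0r.
have [K K0 hK] := enorm_mulmx_bounded M.
exists K => _ [v v1 <-]; have := hK v.
by move: v1; rewrite /sphere /= => ->; rewrite mulr1.
Qed.

Lemma enorm_mulmx_le_opnorm M v : (0 < n)%N ->
  enorm (M *m v) <= opnorm M * enorm v.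
Proof.
move=> hn; have [v0|v0] := eqVneq (enorm v) 0.
  have [K K0 hK] := enorm_mulmx_bounded M.
  by apply: le_trans (hK v) _; rewrite v0 !mulr0.
have vp : 0 < enorm v by rewrite lt_def v0 enorm_ge0.
rewrite -ler_pdivrMr //.
apply: ub_le_sup; first by have [] := has_sup_opnorm M hn.
exists ((enorm v)^-1 *: v).
  by rewrite /sphere /= enormZ ger0_norm ?invr_ge0 ?enorm_ge0 // mulVf.
by rewrite -scalemxAr enormZ ger0_norm ?invr_ge0 ?enorm_ge0 // mulrC.
Qed.

End EuclideanTheory.

(** * Continuity of paths on an interval *)

Section WithinContinuity.
Context {R : realType}.

Lemma within_continuousP {V : normedModType R} (A : set R) (f : R -> V) :
  {within A, continuous f} <->
  forall x, A x -> forall e : R, 0 < e ->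
    exists2 r : R, 0 < r & forall y, A y -> `|x - y| < r -> `|f x - f y| < e.
Proof.
rewrite subspace_continuousP; split => h x Ax.
  move=> e e0; have /cvgrPdist_lt /(_ e e0) := h x Ax.
  move=> [r /= r0 hr]; exists r => // y Ay xy.
  exact: hr.
apply/cvgrPdist_lt => e e0; have [r r0 hr] := h x Ax e e0.
by exists r => //= y /= xy Ay; apply: hr.
Qed.

Lemma within_continuous_unif {V : normedModType R} (a b : R) (f : R -> V) :
  {within `[a, b], continuous f} -> forall e : R, 0 < e ->
  exists2 r : R, 0 < r &
    forall x y, a <= x <= b -> a <= y <= b -> `|x - y| < r ->
      `|f x - f y| < e.
Proof.
move=> /within_continuousP fc e e0.
have /compact_near_coveringP cov := @segment_compact R a b.
have /(_ (fun r x => a <= x <= b -> forall y, a <= y <= b ->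
  `|x - y| < r -> `|f x - f y| < e)) :=
    cov R (0%R : R)^'+ _.
case=> [x xab|r /= r0 /(_ (r / 2))].
  have xab' : [set` `[a, b]] x by [].
  have [r r0 hr] := fc x xab' _ (divr_gt0 e0 (ltr0n _ 2)).
  near=> x' s => /= x'ab y yab x'y.
  have xx' : `|x - x'| < r / 2.
    by near: x'; exists (r / 2); rewrite /= ?divr_gt0.
  have sr : s < r / 2.
    by near: s; apply: nbhs_right_lt; rewrite divr_gt0.
  have xx'f : `|f x - f x'| < e / 2.
    by apply: hr; rewrite /= ?in_itv //=; lra.
  have xyf : `|f x - f y| < e / 2.
    apply: hr; rewrite /= ?in_itv //=.
    rewrite -(subrKA x'); apply: le_lt_trans (ler_normD _ _) _; lra.
  rewrite -(subrKA (f x)); apply: le_lt_trans (ler_normD _ _) _.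
  rewrite (distrC (f x')); lra.
move=> hr; exists (r / 2); first by rewrite divr_gt0.
move=> x y xab yab; apply: hr => //.
  by rewrite /= sub0r normrN gtr0_norm ?divr_gt0 //; lra.
exact: divr_gt0.
Unshelve. all: by end_near. Qed.

Lemma mx_norm_coord {m k : nat} (M : 'M[R]_(m, k)) i j : `|M i j| <= `|M|.
Proof.
rewrite [leRHS]/Num.Def.normr/= mx_normrE.
exact: (le_bigmax _ (fun ij => `|M ij.1 ij.2|) (i, j)).
Qed.

Lemma mx_norm_le {m k : nat} (M : 'M[R]_(m, k)) (c : R) : 0 <= c ->
  (forall i j, `|M i j| <= c) -> `|M| <= c.
Proof.
move=> c0 h; rewrite [leLHS]/Num.Def.normr/= mx_normrE.
by apply: bigmax_le => // -[i j] _; apply: h.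
Qed.

Lemma cvg_mx {T : Type} {F : set_system T} {FF : Filter F} {m k : nat}
    (f : T -> 'M[R]_(m, k)) (l : 'M[R]_(m, k)) :
  (forall i j, f x i j @[x --> F] --> l i j) -> f x @[x --> F] --> l.
Proof.
move=> h; apply/cvgrPdist_le => e e0; near=> x.
apply: mx_norm_le => [|i j]; first exact: ltW.
rewrite !mxE; move: i j; near: x; apply: filter_forall => i.
apply: filter_forall => j; exact: ((cvgrPdist_le _ _).1 (h i j)).
Unshelve. all: by end_near. Qed.

Lemma within_continuous_mx {m k : nat} (A : set R) (f : R -> 'M[R]_(m, k)) :
  {within A, continuous f} <->
  forall i j, {within A, continuous (fun t => f t i j)}.
Proof.
rewrite subspace_continuousP; split => h.
  move=> i j; apply/subspace_continuousP => x Ax.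
  apply: (@cvg_comp _ _ _ f (fun M : 'M[R]_(m, k) => M i j) _ _ _ (h x Ax)).
  exact: coord_continuous.
move=> x Ax; apply: cvg_mx => i j.
exact: ((subspace_continuousP _ _).1 (h i j) x Ax).
Qed.

Lemma within_continuousM (A : set R) (f g : R -> R) :
  {within A, continuous f} -> {within A, continuous g} ->
  {within A, continuous (fun t => f t * g t)}.
Proof. by move=> cf cg x; apply: cvgM; [exact: cf|exact: cg]. Qed.

Lemma within_continuous_sum (A : set R) (I : Type) (r : seq I) (f : I -> R -> R) :
  (forall i, {within A, continuous (f i)}) ->
  {within A, continuous (fun t => \sum_(i <- r) f i t)}.
Proof.
move=> cf; elim: r => [|i r IH].
  by under eq_fun do rewrite big_nil; move=> x; apply: cvg_cst.
under eq_fun do rewrite big_cons.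
by move=> x; apply: cvgD; [exact: cf|exact: IH].
Qed.

Lemma within_continuous_mulmx {m k l : nat} (A : set R) (M : 'M[R]_(m, k))
    (f : R -> 'M[R]_(k, l)) :
  {within A, continuous f} -> {within A, continuous (fun t => M *m f t)}.
Proof.
move=> /within_continuous_mx cf; apply/within_continuous_mx => i j.
under eq_fun do rewrite mxE.
apply: within_continuous_sum => p; apply: within_continuousM => //.
by move=> x; apply: cvg_cst.
Qed.

Lemma within_continuous_dot {n : nat} (A : set R) (u v : R -> 'cV[R]_n) :
  {within A, continuous u} -> {within A, continuous v} ->
  {within A, continuous (fun t => dot (u t) (v t))}.
Proof.
move=> /within_continuous_mx cu /within_continuous_mx cv.
by apply: within_continuous_sum => p; apply: within_continuousM.
Qed.

Lemma within_continuous_enorm {n : nat} (A : set R) (u : R -> 'cV[R]_n) :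
  {within A, continuous u} -> {within A, continuous (fun t => enorm (u t))}.
Proof.
move=> cu x.
apply: (@continuous_comp (subspace A) R R (fun t => dot (u t) (u t)) Num.sqrt).
  exact: within_continuous_dot.
exact: sqrt_continuous.
Qed.

Lemma within_continuous_bounded {n : nat} (a b : R) (u : R -> 'cV[R]_n) :
  {within `[a, b], continuous u} ->
  exists2 r : R, 0 < r & forall t : R, a <= t <= b -> enorm (u t) <= r.
Proof.
move=> cu; have [ab|ab] := leP a b; last first.
  by exists 1 => // t /andP[at_ tb]; have := le_trans at_ tb; lra.
have [c _ hc] := EVT_max ab (within_continuous_enorm cu).
exists (enorm (u c) + 1) => [|t tab]; first by have := enorm_ge0 (u c); lra.
by have := hc t tab; lra.
Qed.

Lemma within_continuous_shift {V : normedModType R} (f : R -> V) (c a b : R) :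
  {within `[(c + a), (c + b)], continuous f} ->
  {within `[a, b], continuous (fun t => f (c + t))}.
Proof.
move=> /within_continuousP fc; apply/within_continuousP => x.
rewrite /= in_itv /= => xab e e0.
have [|r r0 hr] := fc (c + x) _ e e0; first by rewrite /= in_itv /=; lra.
exists r => // y; rewrite /= in_itv /= => yab xy.
apply: hr; first by rewrite /= in_itv /=; lra.
by rewrite (_ : c + x - (c + y) = x - y) //; ring.
Qed.

End WithinContinuity.

(** * Gronwall's lemma *)

Section Gronwall.
Context {R : realType}.

Lemma is_derive_shiftl {V : normedModType R} (f : R -> V) (c t : R) (df : V) :
  is_derive (c + t) 1 f df -> is_derive t 1 (fun s => f (c + s)) df.
Proof.
move=> [dv dE].
have E : (fun h => h^-1 *: (((fun s => f (c + s)) \o shift t) (h *: (1 : R)) - f (c + t)))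
   = (fun h => h^-1 *: ((f \o shift (c + t)) (h *: (1 : R)) - f (c + t))).
  by apply/funext => h; rewrite /= addrCA.
apply: DeriveDef; first by rewrite /derivable E.
by rewrite /derive E.
Qed.

Lemma is_derive_mxP {m k : nat} (M : R -> 'M[R]_(m, k)) (t : R) D :
  is_derive t 1 M D <->
  forall i j, is_derive t 1 (fun s => M s i j) (D i j).
Proof.
split=> [[dv <-] i j|h].
  apply: DeriveDef; first exact: (derivable_mxP _ _ _).1 dv i j.
  by rewrite derive_mx // mxE.
have dv : derivable M t 1 by apply/derivable_mxP => i j; have [] := h i j.
apply: DeriveDef => //; rewrite derive_mx //; apply/matrixP => i j.
by rewrite mxE; have [_ ->] := h i j.
Qed.

Lemma is_derive_dotvv {n : nat} (u : R -> 'cV[R]_n) (f : 'cV[R]_n) (t : R) :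
  is_derive t 1 u f -> is_derive t 1 (fun s => dot (u s) (u s)) (2 * dot (u t) f).
Proof.
move=> /is_derive_mxP du.
have E : (fun s => dot (u s) (u s)) =
    \sum_(i < n) ((fun s => u s i 0) * (fun s => u s i 0)).
  by apply/funext => s; rewrite /dot fct_sumE.
rewrite E.
have dsum := is_derive_sum (fun i : 'I_n => is_deriveM (du i 0) (du i 0)).
apply: (is_derive_eq dsum); rewrite /dot mulr_sumr; apply: eq_bigr => i _.
by rewrite /GRing.scale /=; ring.
Qed.

Lemma is_derive_linear (c x : R) : is_derive x 1 (fun s : R => c * s) c.
Proof.
have d := @is_deriveZ _ _ _ (@id R) c x 1 1 (is_derive_id x 1).
by apply: (is_derive_eq d); rewrite /GRing.scale /= mulr1.
Qed.

(** The function [exp (- c t) g t - e t] is nonincreasing. *)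
Lemma gronwall (g dg : R -> R) (T c e : R) : 0 <= c -> 0 <= e ->
  {within `[0, T], continuous g} ->
  (forall t : R, 0 < t -> t < T -> is_derive t 1 g (dg t)) ->
  (forall t : R, 0 < t -> t < T -> dg t <= c * g t + e) ->
  forall t : R, 0 <= t <= T -> g t <= (g 0 + t * e) * expR (c * t).
Proof.
move=> c0 e0 gc gd dgle t /andP[t0 tT].
pose k s := expR (- c * s) * g s - e * s.
have kd s : 0 < s -> s < T ->
    is_derive s 1 k (expR (- c * s) * (dg s - c * g s) - e).
  move=> s0 sT; have ds := gd s s0 sT.
  have de : is_derive s 1 (fun s => expR (- c * s)) (- c * expR (- c * s)).
    rewrite mulrC; apply: (@is_derive1_comp _ expR (fun s => - c * s)).
    exact: is_derive_linear.
  have dk := is_deriveB (is_deriveM de ds) (is_derive_linear e s).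
  by apply: (is_derive_eq dk); rewrite /GRing.scale /=; ring.
have kc : {within `[0, T], continuous k}.
  move=> x; apply: cvgB; last by apply: continuous_subspaceT => y; apply: mulrl_continuous.
  apply: cvgM; last exact: gc.
  apply: continuous_subspaceT => y.
  apply: (@continuous_comp _ _ _ (fun z => - c * z) expR).
    exact: mulrl_continuous.
  exact: continuous_expR.
have : k t <= k 0.
  apply: (@ler0_derive1_le_cc _ k 0 T) => //.
  - by move=> x; rewrite in_itv /= => /andP[x0 xT]; have [] := kd x x0 xT.
  - move=> x; rewrite in_itv /= => /andP[x0 xT].
    have kdx := kd x x0 xT; rewrite derive1E derive_val subr_le0.
    have ex1 : expR (- c * x) <= 1.
      by rewrite -expR0 ler_expR mulNr oppr_le0 mulr_ge0 // ltW.
    apply: (@le_trans _ _ (expR (- c * x) * e)); last first.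
      by rewrite ler_piMl.
    by apply: ler_wpM2l; [exact: expR_ge0|have := dgle x x0 xT; lra].
  - by rewrite in_itv /= t0.
  - by rewrite in_itv /= lexx (le_trans t0).
rewrite /k !mulr0 expR0 mul1r subr0 lerBlDr mulNr expRN => h.
rewrite -ler_pdivrMr ?expR_gt0 // mulrC [t * e]mulrC; exact: h.
Qed.

(** The squared norm has derivative [2 u.f], which is at most
    [(2 K + 1) |u|^2 + eta^2]; unlike the norm, it is differentiable at 0. *)
Lemma gronwall_enorm {n : nat} (u f : R -> 'cV[R]_n) (T K eta : R) : 0 <= K ->
  0 <= eta ->
  {within `[0, T], continuous u} ->
  (forall t : R, 0 < t -> t < T -> is_derive t 1 u (f t)) ->
  (forall t : R, 0 < t -> t < T ->
     dot (u t) (f t) <= K * enorm (u t) ^+ 2 + eta * enorm (u t)) ->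
  forall t : R, 0 <= t <= T ->
    enorm (u t) ^+ 2 <=
    (enorm (u 0) ^+ 2 + t * eta ^+ 2) * expR ((2 * K + 1) * t).
Proof.
move=> K0 eta0 uc ud hd t tT; rewrite !enorm_sqr.
apply: (@gronwall (fun s => dot (u s) (u s)) (fun s => 2 * dot (u s) (f s)) T)
  => //.
- lra.
- exact: sqr_ge0.
- exact: within_continuous_dot.
- by move=> s s0 sT; apply: is_derive_dotvv; apply: ud.
- move=> s s0 sT; rewrite -enorm_sqr; have := hd s s0 sT.
  by have := sqr_ge0 (enorm (u s) - eta); nra.
Qed.

(** The constant is chosen before the time [S]: the tangent flow is compared on
    intervals whose length is itself fixed by the outcome of this lemma. *)
Lemma gronwall_small {n : nat} (T K : R) : 0 <= K -> 0 <= T ->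
  exists2 C : R, 0 < C &
  forall (S eta : R) (u f : R -> 'cV[R]_n),
  S <= T -> 0 <= eta -> {within `[0, S], continuous u} ->
  (forall t : R, 0 < t -> t < S -> is_derive t 1 u (f t)) ->
  (forall t : R, 0 < t -> t < S ->
     dot (u t) (f t) <= K * enorm (u t) ^+ 2 + eta * enorm (u t)) ->
  enorm (u 0) <= eta ->
  forall t : R, 0 <= t <= S -> enorm (u t) <= C * eta.
Proof.
move=> K0 T0.
pose D := (1 + T) * expR ((2 * K + 1) * T).
have D0 : 0 < D by rewrite mulr_gt0 ?expR_gt0 //; lra.
exists (Num.sqrt D); first by rewrite sqrtr_gt0.
move=> S eta u f ST eta0 uc ud hd u0 t tS.
rewrite -ler_sqr ?nnegrE ?mulr_ge0 ?sqrtr_ge0 ?enorm_ge0 //.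
have /le_trans := gronwall_enorm K0 eta0 uc ud hd tS; apply.
rewrite exprMn (sqr_sqrtr (ltW D0)) /D mulrAC; have /andP[t0 tS'] := tS.
have tT' := le_trans tS' ST.
apply: ler_pM.
- apply: addr_ge0; first exact: sqr_ge0.
  by apply: mulr_ge0 => //; exact: sqr_ge0.
- exact: expR_ge0.
- rewrite mulrDl mul1r lerD //; first by rewrite ler_sqr ?nnegrE ?enorm_ge0.
  by apply: ler_wpM2r; rewrite ?sqr_ge0.
- by rewrite ler_expR; apply: ler_wpM2l => //; lra.
Qed.

End Gronwall.

(** * Regularity of the drift and of its Jacobian *)

Section LipschitzBounds.
Context {R : realType} {n : nat}.
Implicit Types (f : 'cV[R]_n -> R) (x y : 'cV[R]_n).

Lemma is_derive_partial f j x (a : R) :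
  derivable f (x + a *: delta_mx j 0) (delta_mx j 0) ->
  is_derive a 1 (fun s : R => f (x + s *: delta_mx j 0))
    (partial j f (x + a *: delta_mx j 0)).
Proof.
move=> df.
have E : (fun h : R => h^-1 *: (((fun s : R => f (x + s *: delta_mx j 0)) \o shift a)
             (h *: (1 : R)) - f (x + a *: delta_mx j 0)))
   = (fun h : R => h^-1 *: ((f \o shift (x + a *: delta_mx j 0)) (h *: delta_mx j 0)
       - f (x + a *: delta_mx j 0))).
  apply/funext => h /=; congr (_ *: (f _ - _)).
  have -> : h *: (1 : R^o) = h by rewrite /GRing.scale /= mulr1.
  by rewrite scalerDl addrCA.
by apply: DeriveDef; [rewrite /derivable E | rewrite /derive E].
Qed.

Definition mix x y (k : nat) : 'cV[R]_n :=
  \col_i (if (i < k)%N then x i 0 else y i 0).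

Lemma mixS x y (k : 'I_n) :
  mix x y k.+1 = mix x y k + (x k 0 - y k 0) *: delta_mx k 0.
Proof.
apply/colP => i; rewrite !mxE eqxx andbT ltnS leq_eqVlt.
have [->|ik] := eqVneq i k; first by rewrite eqxx ltnn mulr1 subrKC.
rewrite mulr0 addr0; case: eqP => // /val_inj; by move/eqP: ik.
Qed.

(** The mean value theorem is applied along the [n] segments from [mix x y k] to
    [mix x y k.+1], so that partial derivatives suffice. These segments stay in
    every box that contains [x] and [y], but may leave a Euclidean ball. *)
Lemma lipschitz_box f (K r : R) :
  (forall j x, derivable f x (delta_mx j 0)) -> 0 <= K ->
  (forall j x, (forall i, `|x i 0| <= r) -> `|partial j f x| <= K) ->
  forall x y, (forall i, `|x i 0| <= r) -> (forall i, `|y i 0| <= r) ->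
    `|f x - f y| <= n%:R * K * enorm (x - y).
Proof.
move=> df K0 hK x y xr yr.
have -> : f x - f y = \sum_(k < n) (f (mix x y k.+1) - f (mix x y k)).
  rewrite -(big_mkord xpredT (fun k => f (mix x y k.+1) - f (mix x y k))).
  rewrite telescope_sumr //; congr (f _ - f _); apply/colP => i.
    by rewrite mxE ltn_ord.
  by rewrite mxE ltn0.
apply: le_trans (ler_norm_sum _ _ _) _.
apply: (@le_trans _ _ (\sum_(k < n) K * enorm (x - y))); last first.
  by rewrite sumr_const card_ord -[leLHS]mulr_natl mulrA.
apply: ler_sum => k _; rewrite mixS.
set a := x k 0 - y k 0; set z := mix x y k.
pose phi (s : R) := f (z + s *: delta_mx k 0).
have dphi (s : R) : is_derive s 1 phi (partial k f (z + s *: delta_mx k 0)).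
  exact: is_derive_partial.
have cphi (u v : R) : {within `[u, v], continuous phi}.
  apply: continuous_subspaceT => s; apply: differentiable_continuous.
  by apply/derivable1_diffP; have [] := dphi s.
have zk : z k 0 = y k 0 by rewrite mxE ltnn.
have box s : Num.min 0 a <= s <= Num.max 0 a ->
    forall i, `|(z + s *: delta_mx k 0) i 0| <= r.
  move=> sa i; rewrite !mxE eqxx andbT.
  have [->|ik] := eqVneq i k; last first.
    by rewrite mulr0 addr0; case: ifP.
  rewrite ltnn mulr1; have := xr k; have := yr k; rewrite !ler_norml.
  move: sa; rewrite /a; case: (leP 0 (x k 0 - y k 0)) => h; lra.
have ha : `|a| <= enorm (x - y) by have := coord_le_enorm (x - y) k; rewrite !mxE.
have -> : f (z + a *: delta_mx k 0) - f z = phi a - phi 0.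
  by rewrite /phi scale0r addr0.
have [a0|a0] := leP 0 a.
  have [c cin ->] := MVT_segment a0 (fun s _ => dphi s) (cphi _ _).
  rewrite subr0 normrM ler_pM //; apply: hK; apply: box.
  by move: cin; rewrite in_itv /= (min_idPl a0) (max_idPr a0).
have [c cin E] := MVT_segment (ltW a0) (fun s _ => dphi s) (cphi _ _).
rewrite distrC E sub0r normrM normrN ler_pM //; apply: hK; apply: box.
by move: cin; rewrite in_itv /= (min_idPr (ltW a0)) (max_idPl (ltW a0)).
Qed.

End LipschitzBounds.

Section Coefficients.
Context {R : realType} {n : nat} (b : 'cV[R]_n -> 'cV[R]_n) (K : R).
Hypothesis hb : forall i, C2 (coord b i).
Hypothesis hK : forall i j k x, `|partial k (partial j (coord b i)) x| <= K.

Let K1 := `|K|.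
Let C := n%:R * K1.

Let K10 : 0 <= K1. Proof. exact: normr_ge0. Qed.

Let C0 : 0 <= C. Proof. exact: mulr_ge0. Qed.

Let partial_lip i j x y :
  `|partial j (coord b i) x - partial j (coord b i) y| <= C * enorm (x - y).
Proof.
have [_ /(_ j) h2] := hb i.
pose r := enorm x + enorm y.
apply: (@lipschitz_box _ _ _ K1 r) => //.
- by move=> k z; have [] := h2 k.
- by move=> k z _; apply: le_trans (hK i j k z) (ler_norm K).
- move=> k; apply: le_trans (coord_le_enorm _ _) _.
  by rewrite /r lerDl enorm_ge0.
- move=> k; apply: le_trans (coord_le_enorm _ _) _.
  by rewrite /r lerDr enorm_ge0.
Qed.

Lemma jac_lipschitz : exists2 CJ : R, 0 <= CJ &
  forall x y v, enorm ((jac b x - jac b y) *m v) <= CJ * enorm (x - y) * enorm v.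
Proof.
exists (n%:R * (n%:R * C)) => [|x y v]; first by rewrite !mulr_ge0.
have -> : n%:R * (n%:R * C) * enorm (x - y) = n%:R * (n%:R * (C * enorm (x - y))).
  by rewrite !mulrA.
apply: enorm_mulmx_le_entry => [|i j]; first by rewrite mulr_ge0 ?enorm_ge0.
by rewrite !mxE; apply: partial_lip.
Qed.

(** The second derivatives are bounded, so the first ones grow at most linearly
    and the drift is Lipschitz on bounded sets. *)
Lemma drift_lipschitz (r : R) : exists2 Cb : R, 0 <= Cb &
  forall x y, enorm x <= r -> enorm y <= r ->
    enorm (b x - b y) <= Cb * enorm (x - y).
Proof.
pose A : R := \sum_i \sum_j `|partial j (coord b i) 0|.
pose D := A + C * (n%:R * `|r|).
have A0 : 0 <= A by apply: sumr_ge0 => i _; apply: sumr_ge0.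
have D0 : 0 <= D by rewrite addr_ge0 ?mulr_ge0.
exists (n%:R * (n%:R * D)) => [|x y xr yr]; first by rewrite !mulr_ge0.
rewrite -!mulrA; apply: enorm_le_coord => [|i].
  by rewrite !mulr_ge0 ?enorm_ge0.
have -> : (b x - b y) i 0 = coord b i x - coord b i y by rewrite /coord !mxE.
rewrite mulrA.
have [h1 _] := hb i.
apply: (@lipschitz_box _ _ _ D `|r|) => //.
- by move=> j; have [] := h1 j.
- move=> j z zr.
  have zn : enorm z <= n%:R * `|r| by apply: enorm_le_coord.
  rewrite -(subrK (partial j (coord b i) 0) (partial j (coord b i) z)).
  apply: le_trans (ler_normD _ _) _; rewrite addrC lerD //.
    rewrite /A (bigD1 i) //= (bigD1 j) //= -addrA lerDl addr_ge0 ?sumr_ge0 //.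
    by move=> k _; apply: sumr_ge0.
  apply: le_trans (partial_lip _ _ _ _) _; rewrite subr0.
  exact: ler_wpM2l.
- move=> k; apply: le_trans (coord_le_enorm _ _) _.
  exact: le_trans xr (ler_norm r).
- move=> k; apply: le_trans (coord_le_enorm _ _) _.
  exact: le_trans yr (ler_norm r).
Qed.

End Coefficients.

(** * Differential equations driven by a continuous noise *)

Section Driven.
Context {R : realType} {n : nat} (b : 'cV[R]_n -> 'cV[R]_n).

(** [y] solves [dy = b(y) dt + dbeta] on [0, T]; the noise [beta] need not be
    differentiable, so the equation is stated for [y - beta]. *)
Definition driven (beta y : R -> 'cV[R]_n) (T : R) :=
  {within `[0, T], continuous (y - beta)} /\
  forall t : R, 0 < t -> t < T -> is_derive t 1 (y - beta) (b (y t)).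

Lemma driven_shift (beta y : R -> 'cV[R]_n) (c T : R) (z : 'cV[R]_n) :
  0 <= c -> driven beta y (c + T) ->
  driven (fun t => beta (c + t) - z) (fun t => y (c + t)) T.
Proof.
move=> c0 [yc yd].
have E : (fun t => y (c + t)) - (fun t => beta (c + t) - z) =
    (fun t => (y - beta) (c + t)) + cst z.
  by apply/funext => t; rewrite !fctE opprB addrCA addrC.
split.
  rewrite E; apply: within_continuousD; last by move=> x; apply: cvg_cst.
  apply: within_continuous_shift; apply: continuous_subspaceW yc.
  by move=> t /=; rewrite !in_itv /= addr0 => /andP[/(le_trans c0) -> ->].
move=> t t0 tT; rewrite E -[b _]addr0.
apply: is_deriveD; apply: is_derive_shiftl; apply: yd; first exact: ltr_wpDl.
by rewrite ltrD2l.
Qed.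

Lemma driven_le (beta y : R -> 'cV[R]_n) (S T : R) :
  S <= T -> driven beta y T -> driven beta y S.
Proof.
move=> ST [yc yd]; split=> [|t t0 tS]; last exact/yd/(lt_le_trans tS).
apply: continuous_subspaceW yc => t /=; rewrite !in_itv /= => /andP[-> h].
exact: le_trans h ST.
Qed.

Lemma variational_shift (y V : R -> 'cV[R]_n) (v : 'cV[R]_n) (c T : R) :
  0 <= c -> variational b y (c + T) v V ->
  variational b (fun t => y (c + t)) T (V c) (fun t => V (c + t)).
Proof.
move=> c0 [_ Vc Vd]; split; first by rewrite addr0.
  apply: within_continuous_shift; apply: continuous_subspaceW Vc.
  by move=> t /=; rewrite !in_itv /= addr0 => /andP[/(le_trans c0) -> ->].
move=> t t0 tT; apply: is_derive_shiftl; apply: Vd; first exact: ltr_wpDl.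
by rewrite ltrD2l.
Qed.

Lemma variational_le (y V : R -> 'cV[R]_n) (v : 'cV[R]_n) (S T : R) :
  S <= T -> variational b y T v V -> variational b y S v V.
Proof.
move=> ST [V0 Vc Vd]; split=> // [|t t0 tS]; last exact/Vd/(lt_le_trans tS).
apply: continuous_subspaceW Vc => t /=; rewrite !in_itv /= => /andP[-> h].
exact: le_trans h ST.
Qed.

End Driven.

(** * Stability of solutions and of tangent flows *)

Section Stability.
Context {R : realType} {n : nat} (b : 'cV[R]_n -> 'cV[R]_n) (L CJ : R).
Hypothesis L0 : 0 <= L.
Hypothesis hL : forall x y : 'cV[R]_n,
  dot (x - y) (b x - b y) <= L * enorm (x - y) ^+ 2.
Hypothesis hlip : forall r : R, exists2 Cb : R, 0 <= Cb &
  forall x y, enorm x <= r -> enorm y <= r ->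
    enorm (b x - b y) <= Cb * enorm (x - y).
Hypothesis CJ0 : 0 <= CJ.
Hypothesis hJ : forall x y v,
  enorm ((jac b x - jac b y) *m v) <= CJ * enorm (x - y) * enorm v.

Lemma small_factor (A eps : R) : 0 <= A -> 0 < eps ->
  exists2 del : R, 0 < del & del <= 1 /\ A * del <= eps.
Proof.
move=> A0 eps0; exists (Num.min 1 (eps / (A + 1))).
  by rewrite lt_min ltr01 divr_gt0 //; lra.
split; first by rewrite ge_min lexx.
apply: (@le_trans _ _ (A * (eps / (A + 1)))).
  by apply: ler_wpM2l => //; rewrite ge_min lexx orbT.
rewrite mulrA ler_pdivrMr; last lra.
nra.
Qed.

(** The difference [u] of the two functions [y - beta] vanishes at 0 and has
    derivative [b y1 - b y2], which is small when [y1] is close to [y2]. *)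
Lemma noise_close (y2 beta2 : R -> 'cV[R]_n) (r T : R) : 0 <= T ->
  (forall t : R, 0 <= t <= T -> enorm (y2 t) <= r) -> driven b beta2 y2 T ->
  forall eps : R, 0 < eps -> exists2 del : R, 0 < del &
  forall y1 beta1, driven b beta1 y1 T ->
    (y1 - beta1) 0 = (y2 - beta2) 0 ->
    (forall t : R, 0 <= t <= T -> enorm (y1 t - y2 t) <= del) ->
    forall t : R, 0 <= t <= T -> enorm (beta1 t - beta2 t) <= eps.
Proof.
move=> T0 y2r [c2 d2] eps eps0.
have [Cb Cb0 hCb] := hlip (r + 1).
have [C C0 hC] := @gronwall_small R n T 0 (lexx _) T0.
have [del del0 [del1 dele]] := @small_factor (C * Cb + 1) eps
  (addr_ge0 (mulr_ge0 (ltW C0) Cb0) ler01) eps0.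
exists del => // y1 beta1 [c1 d1] E0 hy.
pose u := (y1 - beta1) - (y2 - beta2).
have u0 : u 0 = 0 by rewrite /u fctE E0 subrr.
have hf t : 0 <= t <= T -> enorm (b (y1 t) - b (y2 t)) <= Cb * del.
  move=> tT; apply: (@le_trans _ _ (Cb * enorm (y1 t - y2 t))); last first.
    by apply: ler_wpM2l => //; apply: hy.
  have := y2r t tT; have := hy t tT; have := ler_enorm_add_dist (y1 t) (y2 t).
  by move=> h1 h2 h3; apply: hCb; lra.
have hu : forall t : R, 0 <= t <= T -> enorm (u t) <= C * (Cb * del).
  apply: (hC T _ u (fun t => b (y1 t) - b (y2 t))).
  - exact: lexx.
  - by rewrite mulr_ge0 // ltW.
  - exact: within_continuousB.
  - by move=> t t0 tT; apply: is_deriveB; [apply: d1 | apply: d2].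
  - move=> t t0 tT; rewrite mul0r add0r mulrC.
    apply: le_trans (dot_le _ _) _; apply: ler_wpM2l; first exact: enorm_ge0.
    by apply: hf; rewrite !ltW.
  - by rewrite u0 enorm0 mulr_ge0 // ltW.
move=> t tT.
have -> : beta1 t - beta2 t = (y1 t - y2 t) - u t.
  by rewrite /u !fctE; apply/colP => i; rewrite !mxE; ring.
apply: le_trans (ler_enormD _ _) _; rewrite enormN.
by have := hu t tT; have := hy t tT; nra.
Qed.

(** Let [u] be the difference of the two functions [y - beta], so that
    [y1 = z + u] with [z = y2 + (beta1 - beta2)]. The one-sided bound between [y1]
    and [z] gives [L |u|^2], however large [u] may be; the local Lipschitz bound
    is used between [z] and [y2] only, which are close to each other. *)
Lemma path_close (y2 beta2 : R -> 'cV[R]_n) (r T : R) : 0 <= T ->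
  (forall t : R, 0 <= t <= T -> enorm (y2 t) <= r) -> driven b beta2 y2 T ->
  forall eps : R, 0 < eps -> exists2 del : R, 0 < del &
  forall y1 beta1, driven b beta1 y1 T ->
    enorm ((y1 - beta1) 0 - (y2 - beta2) 0) <= del ->
    (forall t : R, 0 <= t <= T -> enorm (beta1 t - beta2 t) <= del) ->
    forall t : R, 0 <= t <= T -> enorm (y1 t - y2 t) <= eps.
Proof.
move=> T0 y2r [c2 d2] eps eps0.
have [Cb Cb0 hCb] := hlip (r + 1).
have [C C0 hC] := @gronwall_small R n T L L0 T0.
have [del del0 [del1 dele]] := @small_factor (C * (Cb + 1) + 1) eps
  (addr_ge0 (mulr_ge0 (ltW C0) (addr_ge0 Cb0 ler01)) ler01) eps0.
exists del => // y1 beta1 [c1 d1] E0 hbeta.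
pose u := (y1 - beta1) - (y2 - beta2).
have hu : forall t : R, 0 <= t <= T -> enorm (u t) <= C * ((Cb + 1) * del).
  apply: (hC T _ u (fun t => b (y1 t) - b (y2 t))).
  - exact: lexx.
  - by rewrite mulr_ge0 //; lra.
  - exact: within_continuousB.
  - by move=> t t0 tT; apply: is_deriveB; [apply: d1 | apply: d2].
  - move=> t t0 tT; have tT' : 0 <= t <= T by rewrite !ltW.
    pose z := y2 t + (beta1 t - beta2 t).
    have -> : b (y1 t) - b (y2 t) = (b (y1 t) - b z) + (b z - b (y2 t)).
      by rewrite subrKA.
    have uE : u t = y1 t - z.
      by rewrite /u /z !fctE; apply/colP => i; rewrite !mxE; ring.
    have hz : enorm (b z - b (y2 t)) <= Cb * del.
      have zE : z - y2 t = beta1 t - beta2 t by rewrite /z addrC addKr.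
      apply: (@le_trans _ _ (Cb * enorm (z - y2 t))); last first.
        by apply: ler_wpM2l => //; rewrite zE; apply: hbeta.
      have := y2r t tT'; have := hbeta t tT'.
      have := ler_enorm_add_dist z (y2 t); rewrite {1}zE => h1 h2 h3.
      by apply: hCb; lra.
    rewrite dotDr; apply: lerD; first by rewrite uE; apply: hL.
    apply: le_trans (dot_le _ _) _; rewrite mulrC.
    by apply: ler_wpM2r; [exact: enorm_ge0|lra].
  - by rewrite /u fctE; apply: le_trans E0 _; nra.
move=> t tT.
have -> : y1 t - y2 t = (beta1 t - beta2 t) + u t.
  by rewrite /u !fctE; apply/colP => i; rewrite !mxE; ring.
apply: le_trans (ler_enormD _ _) _.
by have := hu t tT; have := hbeta t tT; nra.
Qed.

Lemma jac_bounded (r : R) : exists2 K : R, 0 <= K &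
  forall x v, enorm x <= r -> enorm (jac b x *m v) <= K * enorm v.
Proof.
have [K K0 hK] := enorm_mulmx_bounded (jac b 0).
exists (CJ * `|r| + K) => [|x v xr]; first by rewrite addr_ge0 // mulr_ge0.
rewrite -(subrK (jac b 0) (jac b x)) mulmxDl.
apply: le_trans (ler_enormD _ _) _; rewrite mulrDl lerD //.
apply: le_trans (hJ _ _ _) _; rewrite subr0.
apply: ler_wpM2r; first exact: enorm_ge0.
by apply: ler_wpM2l => //; apply: le_trans xr (ler_norm r).
Qed.

(** The tolerance [del] is chosen before the duration [S0] of the comparison: it
    determines how short the first stage of the trajectory must be, hence how
    much time is left for the second. *)
Lemma flow_close (y2 U : R -> 'cV[R]_n) (u0 : 'cV[R]_n) (r T : R) : 0 <= T ->
  (forall t : R, 0 <= t <= T -> enorm (y2 t) <= r) -> variational b y2 T u0 U ->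
  forall eps : R, 0 < eps -> exists2 del : R, 0 < del &
  forall S0 y1 V v0, S0 <= T -> variational b y1 S0 v0 V ->
    enorm (v0 - u0) <= del ->
    (forall t : R, 0 <= t <= S0 -> enorm (y1 t - y2 t) <= del) ->
    forall t : R, 0 <= t <= S0 -> enorm (V t - U t) <= eps.
Proof.
move=> T0 y2r [U0 cU dU] eps eps0.
have [M M0 hM] := within_continuous_bounded cU.
have [K K0 hK] := jac_bounded (r + 1).
have [C C0 hC] := @gronwall_small R n T K K0 T0.
have [del del0 [del1 dele]] := @small_factor (C * (CJ * M + 1)) eps
  (mulr_ge0 (ltW C0) (addr_ge0 (mulr_ge0 CJ0 (ltW M0)) ler01)) eps0.
exists del => // S y1 V v0 ST [V0 cV dV] uv0 hy t tS.
have CJM : 0 <= CJ * M by rewrite mulr_ge0 // ltW.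
apply: le_trans dele; rewrite -mulrA.
have cU' : {within `[0, S], continuous U}.
  apply: continuous_subspaceW cU => s; rewrite /= !in_itv /= => /andP[-> h].
  exact: le_trans h ST.
apply: (hC S _ (V - U) (fun t => jac b (y1 t) *m V t - jac b (y2 t) *m U t)) => //.
- by rewrite mulr_ge0 //; lra.
- exact: within_continuousB.
- move=> s s0 sS; apply: is_deriveB; [exact: dV | apply: dU => //].
  exact: lt_le_trans sS ST.
- move=> s s0 sS; have sS' : 0 <= s <= S by rewrite !ltW.
  have sT' : 0 <= s <= T by rewrite (ltW s0) (le_trans (ltW sS) ST).
  have -> : jac b (y1 s) *m V s - jac b (y2 s) *m U s =
      jac b (y1 s) *m (V s - U s) + (jac b (y1 s) - jac b (y2 s)) *m U s.
    by rewrite mulmxBr mulmxBl subrKA.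
  rewrite fctE dotDr; apply: lerD.
    apply: le_trans (dot_le _ _) _.
    rewrite expr2 mulrCA; apply: ler_wpM2l; first exact: enorm_ge0.
    apply: hK; have := y2r s sT'; have := hy s sS'.
    by have := ler_enorm_add_dist (y1 s) (y2 s); lra.
  apply: le_trans (dot_le _ _) _; rewrite mulrC.
  apply: ler_wpM2r; first exact: enorm_ge0.
  apply: le_trans (hJ _ _ _) _.
  apply: (@le_trans _ _ (CJ * del * M)); last by nra.
  apply: ler_pM; rewrite ?mulr_ge0 ?enorm_ge0 //; last exact: hM.
  by apply: ler_wpM2l => //; apply: hy.
- by rewrite !fctE V0 U0; nra.
Qed.

Lemma flow_short (K : R) (v0 : 'cV[R]_n) : 0 <= K ->
  forall eps : R, 0 < eps -> exists2 del0 : R, 0 < del0 &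
  forall (del : R) y V, 0 <= del -> del <= del0 -> variational b y del v0 V ->
    (forall (t : R) w, 0 <= t <= del -> enorm (jac b (y t) *m w) <= K * enorm w) ->
    enorm (V del - v0) <= eps.
Proof.
move=> K0 eps eps0.
pose A := (K * enorm v0) ^+ 2 * expR (2 * K + 1).
have A0 : 0 <= A by rewrite mulr_ge0 ?sqr_ge0 ?expR_ge0.
have [del0 d0 [d1 dA]] := @small_factor A (eps ^+ 2) A0 (exprn_gt0 2 eps0).
exists del0 => // del y V del_ge0 dd [V0 cV dV] hK.
rewrite -ler_sqr ?nnegrE ?enorm_ge0 ?(ltW eps0) //.
have Kv0 : 0 <= K * enorm v0 by rewrite mulr_ge0 // enorm_ge0.
have := @gronwall_enorm R n (V - cst v0) (fun t => jac b (y t) *m V t) del K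
  (K * enorm v0) K0 Kv0.
move=> /(_ _ _ _ del); rewrite !fctE V0 subrr enorm0 expr0n add0r /=.
rewrite del_ge0 lexx => h.
apply: (@le_trans _ _ (del * (K * enorm v0) ^+ 2 * expR ((2 * K + 1) * del))).
  apply: h => //.
  - by apply: within_continuousB => // x; apply: cvg_cst.
  - move=> t t0 td; rewrite -[_ *m _]subr0; apply: is_deriveB; exact: dV.
  - move=> t t0 td; rewrite -{2}(subrK v0 (V t)) mulmxDr dotDr.
    have td' : 0 <= t <= del by rewrite !ltW.
    apply: lerD; apply: le_trans (dot_le _ _) _; last first.
      by rewrite mulrC; apply: ler_wpM2r; [exact: enorm_ge0|apply: hK].
    rewrite expr2 mulrCA; apply: ler_wpM2l; first exact: enorm_ge0.
    exact: hK.
apply: le_trans dA; rewrite [A * _]mulrC /A [del0 * _]mulrA; apply: ler_pM.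
- by apply: mulr_ge0 => //; exact: sqr_ge0.
- exact: expR_ge0.
- by apply: ler_wpM2r => //; exact: sqr_ge0.
- by rewrite ler_expR ler_piMr //; lra.
Qed.

End Stability.

(** * The integral form of the equation *)

Section Integral.
Context {R : realType} {n : nat} (b : 'cV[R]_n -> 'cV[R]_n).
Hypothesis hlip : forall r : R, exists2 Cb : R, 0 <= Cb &
  forall x y, enorm x <= r -> enorm y <= r ->
    enorm (b x - b y) <= Cb * enorm (x - y).

Definition drift_integral (y : R -> 'cV[R]_n) (t : R) : 'cV[R]_n :=
  \col_i (\int[lebesgue_measure]_(s in `[0, t]) b (y s) i 0)%R.

Lemma within_continuous_drift (y : R -> 'cV[R]_n) (T : R) :
  {within `[0, T], continuous y} ->
  {within `[0, T], continuous (fun t => b (y t))}.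
Proof.
move=> yc; have [r r0 yr] := within_continuous_bounded yc.
have [Cb Cb0 hCb] := hlip r.
apply/within_continuous_mx => i j; rewrite (ord1 j).
apply/within_continuousP => t tT e e0.
have [del del0 [_ dele]] := @small_factor R (Cb * n%:R + 1) (e / 2)
   (addr_ge0 (mulr_ge0 Cb0 (ler0n _ _)) ler01) (divr_gt0 e0 (ltr0n _ 2)).
move/within_continuousP : yc => /(_ t tT del del0) [s s0 hs].
exists s => // t' tT' tt'.
have -> : b (y t) i 0 - b (y t') i 0 = (b (y t) - b (y t')) i 0.
  by rewrite !mxE.
apply: le_lt_trans (coord_le_enorm _ _) _.
apply: (@le_lt_trans _ _ (Cb * (n%:R * del))).
  apply: (@le_trans _ _ (Cb * enorm (y t - y t'))).
    by apply: hCb; apply: yr.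
  apply: ler_wpM2l => //; apply: enorm_le_coord => [|k]; first exact: ltW.
  exact: le_trans (mx_norm_coord _ _ _) (ltW (hs t' tT' tt')).
nra.
Qed.

Lemma drift_integralP (y : R -> 'cV[R]_n) (T : R) : 0 <= T ->
  {within `[0, T], continuous y} ->
  {within `[0, T], continuous (drift_integral y)} /\
  forall t : R, 0 < t -> t < T -> is_derive t 1 (drift_integral y) (b (y t)).
Proof.
move=> T0 /within_continuous_drift /within_continuous_mx bc.
have bi i : (@lebesgue_measure R).-integrable `[0, T]
    (EFin \o (fun s => b (y s) i 0)).
  by apply: continuous_compact_integrable; [exact: segment_compact|exact: bc].
have E i j : (fun t => drift_integral y t i j) = (fun t =>
    parameterized_integral lebesgue_measure 0 t (fun s => b (y s) i 0)).
  by apply/funext => t; rewrite mxE.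
split.
  apply/within_continuous_mx => i j.
  by rewrite E; apply: parameterized_integral_continuous.
move=> t t0 tT; apply/is_derive_mxP => i j; rewrite (ord1 j).
rewrite E.
have fc : {for t, continuous (fun s => b (y s) i 0)}.
  apply: (within_continuous_continuous (lt_trans t0 tT) (bc i 0)).
  by rewrite in_itv /= t0.
have [dF F'] := continuous_FTC1_closed tT (bi i) t0 fc.
apply: DeriveDef; first exact: dF.
by rewrite -derive1E; exact: F'.
Qed.

Lemma driven_of_integral (x : 'cV[R]_n) (beta y : R -> 'cV[R]_n) (T : R) :
  0 <= T -> {within `[0, T], continuous y} ->
  (forall t : R, 0 <= t -> y t = x + drift_integral y t + beta t) ->
  driven b beta y T.
Proof.
move=> T0 yc hy; have [cI dI] := drift_integralP T0 yc.
have E t : 0 <= t -> (y - beta) t = cst x t + drift_integral y t.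
  by move=> t0; rewrite fctE hy // addrK.
split.
  have : {within `[0, T], continuous (cst x + drift_integral y)}.
    by apply: within_continuousD => // z; apply: cvg_cst.
  apply: subspace_eq_continuous => t; rewrite inE /= in_itv /= => /andP[t0 _].
  by rewrite [RHS]E.
move=> t t0 tT.
have dt : is_derive t 1 (cst x + drift_integral y) (b (y t)).
  by rewrite -[b _]add0r; apply: is_deriveD; apply: dI.
apply: near_eq_is_derive dt; near=> s; rewrite [RHS]E // ltW //.
by near: s; exact: lt_nbhsr.
Unshelve. all: by end_near. Qed.

End Integral.

(** * Dyadic grids and tubes *)

Section Grid.
Context {R : realType}.

Definition grid (a b : R) (N k : nat) : R := a + (b - a) * (k%:R / (2 ^ N)%:R).

Lemma grid_in (a b : R) N k : a <= b -> (k <= 2 ^ N)%N -> a <= grid a b N k <= b.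
Proof.
move=> ab kN.
have q0 : 0 <= k%:R / (2 ^ N)%:R :> R by rewrite divr_ge0.
have q1 : k%:R / (2 ^ N)%:R <= 1 :> R.
  by rewrite ler_pdivrMr ?ltr0n ?expn_gt0 // mul1r ler_nat.
rewrite /grid; nra.
Qed.

Lemma gridS (a b : R) N k : grid a b N.+1 (k.*2) = grid a b N k.
Proof.
have h : (2 ^ N)%:R != 0 :> R by rewrite pnatr_eq0 -lt0n expn_gt0.
congr (a + (b - a) * _); rewrite expnS -muln2 mulnC !natrM.
by rewrite -mulf_div divff // mul1r.
Qed.

Lemma grid0 (a b : R) N : grid a b N 0 = a.
Proof. by rewrite /grid mul0r mulr0 addr0. Qed.

Lemma grid_last (a b : R) N : grid a b N (2 ^ N) = b.
Proof.
have h : (2 ^ N)%:R != 0 :> R by rewrite pnatr_eq0 -lt0n expn_gt0.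
by rewrite /grid divff // mulr1 subrKC.
Qed.

Lemma grid_lt (a b : R) N k l : a < b -> (k < l)%N -> grid a b N k < grid a b N l.
Proof.
move=> ab kl; rewrite /grid ltrD2l ltr_pM2l ?subr_gt0 //.
by rewrite ltr_pM2r ?ltr_nat // invr_gt0 ltr0n expn_gt0.
Qed.

Lemma grid_dense (a b t r : R) : a <= t <= b -> 0 < r ->
  exists N k, (k <= 2 ^ N)%N /\ `|t - grid a b N k| < r.
Proof.
move=> /andP[at_ tb] r0.
have [ab|ba] := ltP a b; last first.
  by exists 0%N, 0%N; split => //; rewrite grid0 ltr_norml; lra.
pose N := Num.truncn ((b - a) / r); exists N.
have ba0 : 0 < b - a by rewrite subr_gt0.
have p0 : 0 < (2 ^ N)%:R :> R by rewrite ltr0n expn_gt0.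
have Nr : (b - a) / r < (2 ^ N)%:R.
  have /andP[_ h] := truncn_itv (ltW (divr_gt0 ba0 r0)).
  by apply: lt_le_trans h _; rewrite ler_nat; apply: ltn_expl.
pose x := (t - a) / (b - a) * (2 ^ N)%:R.
have x0 : 0 <= x by rewrite mulr_ge0 ?divr_ge0 // ?subr_ge0 // ltW.
have /andP[kx xk] := truncn_itv x0; exists (Num.truncn x); split.
  rewrite -(ler_nat R); apply: le_trans kx _; rewrite /x ler_piMl ?(ltW p0) //.
  by rewrite ler_pdivrMr // mul1r lerD2r.
set k := Num.truncn x in kx xk *.
have tE : t = a + (b - a) * (x / (2 ^ N)%:R).
  by rewrite /x mulfK ?gt_eqF // mulrC divfK ?gt_eqF // subrKC.
have -> : t - grid a b N k = (b - a) * ((x - k%:R) / (2 ^ N)%:R).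
  by rewrite {1}tE /grid mulrBl; ring.
rewrite ger0_norm; last first.
  by rewrite !mulr_ge0 ?invr_ge0 ?subr_ge0 // ltW.
rewrite mulrA ltr_pdivrMr //.
rewrite ltr_pdivrMr // in Nr; rewrite mulrC [r * _]mulrC.
apply: le_lt_trans Nr; rewrite ler_piMl ?(ltW ba0) //.
by rewrite -natr1 in xk; lra.
Qed.

Lemma grid_le_all (g : R -> R) (a b e : R) :
  {within `[a, b], continuous g} ->
  (forall N k, (k <= 2 ^ N)%N -> g (grid a b N k) <= e) ->
  forall t : R, a <= t <= b -> g t <= e.
Proof.
move=> /within_continuousP gc ge t tab; rewrite leNgt; apply/negP => egt.
have gte : 0 < g t - e by rewrite subr_gt0.
have [r r0 hr] := gc t tab _ gte.
have [N [k [kN tk]]] := grid_dense tab r0.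
have ab : a <= b by have /andP[h1 h2] := tab; apply: le_trans h1 h2.
have := hr (grid a b N k) (grid_in ab kN) tk; have := ge N k kN.
by rewrite ltr_norml; lra.
Qed.

End Grid.

Section Tubes.
Context {R : realType} {d : measure_display} {Omega : measurableType d} {n : nat}.

Definition process_on (a b : R) (Z : R -> Omega -> 'cV[R]_n) :=
  (forall t : R, a <= t <= b -> forall i, measurable_fun setT (fun w => Z t w i 0)) /\
  forall w, {within `[a, b], continuous (fun t => Z t w)}.

Definition tube (a b e : R) (Z : R -> Omega -> 'cV[R]_n) : set Omega :=
  [set w | forall t : R, a <= t <= b -> enorm (Z t w) <= e].

Definition grid_tube (a b e : R) (Z : R -> Omega -> 'cV[R]_n) (N : nat) : set Omega :=
  [set w | forall k, (k <= 2 ^ N)%N -> enorm (Z (grid a b N k) w) <= e].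

Lemma measurable_enorm (f : Omega -> 'cV[R]_n) :
  (forall i, measurable_fun setT (fun w => f w i 0)) ->
  measurable_fun setT (fun w => enorm (f w)).
Proof.
move=> mf; apply: (@measurableT_comp _ _ _ _ _ _ (@Num.sqrt R) _ (fun w => dot (f w) (f w))).
  by apply: continuous_measurable_fun; exact: sqrt_continuous.
by apply: measurable_sum => i; apply: measurable_funM.
Qed.

Lemma measurable_enorm_le (f : Omega -> 'cV[R]_n) (e : R) :
  (forall i, measurable_fun setT (fun w => f w i 0)) ->
  measurable [set w | enorm (f w) <= e].
Proof.
move=> /measurable_enorm mf.
have -> : [set w | enorm (f w) <= e] =
    setT `&` (fun w => enorm (f w)) @^-1` [set` `]-oo, e]].
  by rewrite setTI; apply/seteqP; split => w /=; rewrite in_itv.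
by apply: mf => //; exact: measurable_itv.
Qed.

(** Tubes are measurable because a continuous path is controlled by its values
    on the dyadic grids. *)
Lemma tubeE (a b e : R) Z : a <= b -> process_on a b Z ->
  tube a b e Z = \bigcap_N grid_tube a b e Z N.
Proof.
move=> ab [_ Zc]; apply/seteqP; split => w hw.
  by move=> N _ k kN; apply: hw; apply: grid_in.
move=> t tab; apply: (grid_le_all (within_continuous_enorm (Zc w))) tab.
by move=> N k kN; apply: hw.
Qed.

Lemma measurable_grid_tube (a b e : R) Z N : a <= b -> process_on a b Z ->
  measurable (grid_tube a b e Z N).
Proof.
move=> ab [Zm _].
have -> : grid_tube a b e Z N =
    \bigcap_(k in `I_(2 ^ N).+1) [set w | enorm (Z (grid a b N k) w) <= e].
  by apply/seteqP; split => w hw k kN; apply: hw.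
apply: bigcap_measurableType => k kN.
by apply: measurable_enorm_le; apply: Zm; apply: grid_in.
Qed.

Lemma measurable_tube (a b e : R) Z : a <= b -> process_on a b Z ->
  measurable (tube a b e Z).
Proof.
move=> ab Zp; rewrite tubeE //; apply: bigcap_measurableType => N _.
exact: measurable_grid_tube.
Qed.

Lemma grid_tube_nincr (a b e : R) Z : nonincreasing_seq (grid_tube a b e Z).
Proof.
apply/nonincreasing_seqP => N; apply/subsetPset => w hw k kN.
by rewrite -gridS; apply: hw; rewrite expnS mul2n leq_double.
Qed.

(** A tube around a path [h] is the centred tube of the process [Z - h]. *)
Lemma process_on_sub (a b : R) Z (h : R -> 'cV[R]_n) :
  process_on a b Z -> {within `[a, b], continuous h} ->
  process_on a b (fun t w => Z t w - h t).
Proof.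
move=> [Zm Zc] hc; split => [t tab i|w].
  under eq_fun do rewrite !mxE.
  by apply: measurable_funD; [exact: Zm|exact: measurable_cst].
exact: within_continuousB.
Qed.

End Tubes.

(** * Almost every trajectory lies in the support of the law *)

Section Support.
Context {R : realType} {d : measure_display} {Omega : measurableType d}.
Variable P : probability Omega R.

(** Think of [D w] as the ball of a fixed radius around [w]. An outcome with a
    null ball belongs to a set [C i] contained in that ball, hence null, and
    there are countably many of these. *)
Lemma ae_ball_gt0 (I : countType) (C : I -> set Omega) (D : Omega -> set Omega) :
  (forall i, measurable (C i)) -> (forall w, measurable (D w)) ->
  (forall w, exists2 i, C i w & C i `<=` D w) ->
  {ae P, forall w, (0 < P (D w))%E}.
Proof.
move=> mC mD CD.
pose F (k : nat) : set Omega :=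
  if unpickle k is Some i then (if P (C i) == 0%E then C i else set0) else set0.
have F0 : P.-negligible (\bigcup_k F k).
  apply: negligible_bigcup => k; rewrite /F; case: (unpickle k) => [i|].
    case: eqP => [Ci0|_]; last exact: negligible_set0.
    by apply/negligibleP.
  exact: negligible_set0.
apply: negligibleS F0 => w /= /negP; rewrite -leNgt => Dw.
have [i Ciw CDi] := CD w; exists (pickle i) => //; rewrite /F pickleK.
suff -> : P (C i) == 0%E by [].
rewrite eq_le measure_ge0 andbT; apply: le_trans Dw.
by apply: le_measure; rewrite ?inE.
Qed.

Context {n : nat}.

Lemma grid_cell (a b t : R) N : a <= t <= b ->
  exists2 k, (k < 2 ^ N)%N & grid a b N k <= t <= grid a b N k.+1.
Proof.
move=> tab; elim: N => [|N [k kN /andP[kt tk]]].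
  exists 0%N => //; rewrite grid0 -[X in grid a b 0 X](expn0 2) grid_last.
  exact: tab.
have [h|h] := leP t (grid a b N.+1 k.*2.+1).
  exists k.*2; last by rewrite gridS kt h.
  by rewrite expnS mul2n ltn_double.
exists k.*2.+1; last by rewrite (ltW h) -doubleS gridS tk.
by rewrite expnS mul2n ltn_Sdouble.
Qed.

Lemma grid_mesh (a b r : R) : a <= b -> 0 < r ->
  exists N, forall k, grid a b N k.+1 - grid a b N k < r.
Proof.
move=> ab r0; pose N := Num.truncn ((b - a) / r); exists N => k.
have ba0 : 0 <= b - a by rewrite subr_ge0.
have p0 : 0 < (2 ^ N)%:R :> R by rewrite ltr0n expn_gt0.
have Nr : (b - a) / r < (2 ^ N)%:R.
  have /andP[_ h] := truncn_itv (divr_ge0 ba0 (ltW r0)).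
  by apply: lt_le_trans h _; rewrite ler_nat; apply: ltn_expl.
have -> : grid a b N k.+1 - grid a b N k = (b - a) / (2 ^ N)%:R.
  by rewrite /grid -natr1; field; rewrite gt_eqF.
by rewrite ltr_pdivrMr // mulrC; rewrite ltr_pdivrMr // in Nr.
Qed.

(** The countable cover consists of the paths close, on each cell of a grid, to a
    constant vector with coordinates in [h] times the integers. Uniform
    continuity makes it a cover, and its members have diameter at most [e]. *)
Lemma tube_cover (a b e : R) (Z : R -> Omega -> 'cV[R]_n) :
  a <= b -> 0 < e -> process_on a b Z ->
  {ae P, forall w, (0 < P (tube a b e (fun t w' => (Z t w' - Z t w)%R)))%E}.
Proof.
move=> ab e0 Zp; have [Zm Zc] := Zp.
pose h : R := e / (4 * n%:R + 1).
have n4 : 0 < 4 * n%:R + 1 :> R by rewrite ltr_wpDl ?mulr_ge0.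
have h0 : 0 < h by rewrite divr_gt0.
pose c := n%:R * (2 * h).
(* two paths at distance c from the same centre are at distance e *)
have ce : c + c <= e.
  have -> : e = h * (4 * n%:R + 1) by rewrite /h divfK ?lt0r_neq0.
  by rewrite /c; lra.
pose center N (s : {ffun 'I_(2 ^ N) * 'I_n -> int}) (k : 'I_(2 ^ N)) : 'cV[R]_n :=
  \col_i (h * (s (k, i))%:~R).
pose I := {N : nat & {ffun 'I_(2 ^ N) * 'I_n -> int}}.
pose C (x : I) : set Omega :=
  \bigcap_(k : 'I_(2 ^ tag x)) tube (grid a b (tag x) k) (grid a b (tag x) k.+1) c
    (fun t w => Z t w - center (tag x) (tagged x) k).
have cell_sub N (k : 'I_(2 ^ N)) t :
    grid a b N k <= t <= grid a b N k.+1 -> a <= t <= b.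
  move=> /andP[kt tk].
  have /andP[h1 _] := grid_in ab (ltnW (ltn_ord k)).
  have /andP[_ h2] := grid_in ab (ltn_ord k).
  by rewrite (le_trans h1 kt) (le_trans tk h2).
have proc w : process_on a b (fun t w' => Z t w' - Z t w).
  exact: process_on_sub.
apply: (@ae_ball_gt0 I C).
- move=> [N s]; apply: fin_bigcap_measurable => // k _.
  have kk : grid a b N k <= grid a b N k.+1.
    by rewrite /grid lerD2l ler_wpM2l ?subr_ge0 // ler_pM2r ?ler_nat ?invr_gt0 ?ltr0n ?expn_gt0.
  apply: measurable_tube => //; apply: process_on_sub; last by move=> x; apply: cvg_cst.
  split=> [t /cell_sub|w]; first exact: Zm.
  apply: continuous_subspaceW (Zc w) => t; rewrite /= !in_itv /=; exact: cell_sub.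
- by move=> w; apply: measurable_tube.
move=> w.
have [r r0 hr] := within_continuous_unif (Zc w) h0.
have [N hN] := grid_mesh ab r0.
pose s : {ffun 'I_(2 ^ N) * 'I_n -> int} := [ffun ki : 'I_(2 ^ N) * 'I_n =>
  Num.floor (Z (grid a b N ki.1) w ki.2 0 / h)].
have near_center (k : 'I_(2 ^ N)) t : grid a b N k <= t <= grid a b N k.+1 ->
    enorm (Z t w - center N s k) <= c.
  move=> tk; apply: enorm_le_coord => [|i]; first by rewrite mulr_ge0 // ltW.
  rewrite !mxE ffunE /=.
  set z := Z (grid a b N k) w i 0.
  have gab : a <= grid a b N k <= b by rewrite grid_in // ltnW.
  have h1 : `|Z t w i 0 - z| < h.
    have : `|Z t w - Z (grid a b N k) w| < h.
      apply: (hr _ _ (cell_sub _ _ _ tk) gab).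
      have := hN k; rewrite ltr_norml; lra.
    apply: le_lt_trans; have := mx_norm_coord (Z t w - Z (grid a b N k) w) i 0.
    by rewrite !mxE.
  have h2 : `|z - h * (Num.floor (z / h))%:~R| <= h.
    have /andP[f1 f2] := floor_itv (z / h).
    rewrite intrD in f2.
    have zE : z = h * (z / h) by rewrite mulrC divfK ?gt_eqF.
    rewrite {1}zE -mulrBr normrM (gtr0_norm h0) ger_pMr // ler_norml.
    by apply/andP; split; lra.
  rewrite -(subrKA z); apply: le_trans (ler_normD _ _) _; lra.
exists (existT _ N s); first by move=> k _ t tk; apply: near_center.
move=> w' Cw' t tab; have [k kN tk] := grid_cell N tab.
have := near_center (Ordinal kN) t tk; have := Cw' (Ordinal kN) Logic.I t tk => /= h1 h2.
have -> : Z t w' - Z t w = (Z t w' - center N s (Ordinal kN)) -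
    (Z t w - center N s (Ordinal kN)) by rewrite opprB subrKA.
apply: le_trans (ler_enormD _ _) _; rewrite enormN; lra.
Qed.

Lemma ae_tube_gt0 (a b : R) (Z : R -> Omega -> 'cV[R]_n) :
  a <= b -> process_on a b Z ->
  {ae P, forall w, forall e : R, 0 < e ->
    (0 < P (tube a b e (fun t w' => (Z t w' - Z t w)%R)))%E}.
Proof.
move=> ab Zp.
have : {ae P, forall w, forall m : nat,
    (0 < P (tube a b m.+1%:R^-1 (fun t w' => (Z t w' - Z t w)%R)))%E}.
  by apply: ae_foralln => m; apply: tube_cover => //; rewrite invr_gt0.
apply: filterS => w hw e e0.
pose m := Num.truncn e^-1.
have me : m.+1%:R^-1 <= e.
  rewrite invf_ple ?posrE //; apply: ltW.
  by have /andP[] := truncn_itv (ltW (etrans (invr_gt0 e) e0)).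
apply: lt_le_trans (hw m) _; apply: le_measure.
- by rewrite inE; apply: measurable_tube => //; apply: process_on_sub => //; have [] := Zp.
- by rewrite inE; apply: measurable_tube => //; apply: process_on_sub => //; have [] := Zp.
- by move=> w' h t tab; apply: le_trans (h t tab) me.
Qed.

End Support.

(** * Joint laws of finite families *)

Section JointLaw.
Context {R : realType} {J : finType}.

Definition rect (A : J -> set R) : set (J -> R) := [set y | forall j, A j (y j)].

(** These sets generate the product sigma-algebra on [J -> R]. *)
Definition rects : set (set (J -> R)) :=
  [set rect A | A in [set A | forall j, measurable (A j)]].

Lemma measurable_proj j :
  measurable_fun setT (fun y : g_sigma_algebraType rects => y j).
Proof.
move=> _ B mB; rewrite setTI; apply: sub_sigma_algebra.
exists (fun k => if k == j then B else setT) => [k|].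
  by case: ifP => // _; apply: measurableT.
apply/seteqP; split => y /= hy; first by have := hy j; rewrite eqxx.
by move=> k; case: eqP => [->|].
Qed.

Lemma setI_closed_rects : setI_closed rects.
Proof.
move=> _ _ [A mA <-] [B mB <-].
exists (fun j => A j `&` B j) => [j|]; first exact: measurableI.
apply/seteqP; split => y; first by move=> h; split => j; have [] := h j.
by move=> [h1 h2] j; split; [exact: h1|exact: h2].
Qed.

Lemma measurable_joint {d} {T : measurableType d} (Y : J -> T -> R) S :
  (forall j, measurable_fun setT (Y j)) ->
  measurable (S : set (g_sigma_algebraType rects)) ->
  measurable [set w | S (Y ^~ w)].
Proof.
move=> mY mS.
have : measurable_fun setT ((fun w => Y ^~ w) : T -> g_sigma_algebraType rects).
  apply: (@measurability _ _ _ (g_sigma_algebraType rects) _ _ rects) => //.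
  move=> _ [_ [A mA <-] <-]; rewrite setTI.
  have -> : (fun w => Y ^~ w) @^-1` rect A = \bigcap_(j : J) (Y j @^-1` A j).
    by apply/seteqP; split => w h j; [move=> _|]; apply: h.
  apply: fin_bigcap_measurable => // j _.
  by rewrite -[X in measurable X]setTI; apply: mY.
by move=> /(_ measurableT S mS); rewrite setTI.
Qed.

(** Rectangles are stable under intersection and generate, so the pi-lambda
    theorem applies. The two families may live on different spaces. *)
Lemma eq_joint_law {d1 d2} {T1 : measurableType d1} {T2 : measurableType d2}
    (P1 : probability T1 R) (P2 : probability T2 R)
    (Y1 : J -> T1 -> R) (Y2 : J -> T2 -> R) :
  (forall j, measurable_fun setT (Y1 j)) ->
  (forall j, measurable_fun setT (Y2 j)) ->
  (forall A, (forall j, measurable (A j)) ->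
     P1 [set w | rect A (Y1 ^~ w)] = P2 [set w | rect A (Y2 ^~ w)]) ->
  forall S : set (g_sigma_algebraType rects), measurable S ->
    P1 [set w | S (Y1 ^~ w)] = P2 [set w | S (Y2 ^~ w)].
Proof.
move=> mY1 mY2 E.
have m1 S mS := measurable_joint (S := S) mY1 mS.
have m2 S mS := measurable_joint (S := S) mY2 mS.
apply: (@dynkin_induction _ (g_sigma_algebraType rects) rects
  (fun S => P1 [set w | S (Y1 ^~ w)] = P2 [set w | S (Y2 ^~ w)])) => //.
- exact: setI_closed_rects.
- by rewrite !probability_setT.
- by move=> _ [A mA <-]; apply: E.
- move=> S mS ES; have := probability_setC P1 (m1 S mS).
  by rewrite ES -(probability_setC P2 (m2 S mS)).
move=> F mF tF EF.
have tr d (T : measurableType d) (Y : J -> T -> R) :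
    trivIset setT (fun k => [set w | F k (Y ^~ w)]).
  move=> i j _ _ [w [h1 h2]]; apply: tF => //; by exists (Y ^~ w).
transitivity (\sum_(k <oo | k \in setT) P1 [set w | F k (Y1 ^~ w)])%E.
  exact: (@measure_bigcup _ _ _ P1 setT (fun k => [set w | F k (Y1 ^~ w)])
    (fun k _ => m1 _ (mF k)) (tr _ _ Y1)).
transitivity (\sum_(k <oo | k \in setT) P2 [set w | F k (Y2 ^~ w)])%E.
  by apply: eq_eseriesr => k _; apply: EF.
apply: esym.
exact: (@measure_bigcup _ _ _ P2 setT (fun k => [set w | F k (Y2 ^~ w)])
  (fun k _ => m2 _ (mF k)) (tr _ _ Y2)).
Qed.

End JointLaw.

(** * Increments of Brownian motion *)

Section ProductProbability.
Context {R : realType} {d1 d2 : measure_display}.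
Context {T1 : measurableType d1} {T2 : measurableType d2}.
Variables (P1 : probability T1 R) (P2 : probability T2 R).

Let product_setT : (P1 \x P2)%E [set: T1 * T2] = 1%E.
Proof.
have -> : [set: T1 * T2] = [set: T1] `*` [set: T2] by rewrite setXTT.
transitivity (P1 setT * P2 setT)%E; first exact: product_measure1E.
by rewrite !probability_setT mule1.
Qed.

HB.instance Definition _ :=
  Measure_isProbability.Build _ _ _ (P1 \x P2)%E product_setT.

End ProductProbability.

Lemma measurable_mulmx_sub {R : realType} {d} {T : measurableType d} {n : nat}
    (M : 'M[R]_n) (f : T -> 'cV[R]_n) (c : 'cV[R]_n) :
  (forall i, measurable_fun setT (fun w => f w i 0)) ->
  forall i, measurable_fun setT (fun w => (M *m f w - c) i 0).
Proof.
move=> mf i.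
apply: (@eq_measurable_fun _ _ _ _ _ (fun w => \sum_j M i j * f w j 0 - c i 0)).
  by move=> w _; rewrite !mxE.
apply: measurable_funB => //; apply: measurable_sum => j.
exact: measurable_funM.
Qed.

Section BrownianIncrements.
Context {R : realType} {d : measure_display} {Omega : measurableType d} {n : nat}.
Variable B : R -> Omega -> 'cV[R]_n.

Definition increment (s t : R) (i : 'I_n) (w : Omega) : R := (B t w - B s w) i 0.

Lemma increasing_times (k : nat) (t : nat -> R) :
  (forall l, (l < k)%N -> t l < t l.+1) ->
  forall l m, (l <= m)%N -> (m <= k)%N -> t l <= t m.
Proof.
move=> ti l; elim=> [|m IH]; first by rewrite leqn0 => /eqP ->.
rewrite leq_eqVlt => /orP[/eqP -> //|lm mk].
exact: le_trans (IH lm (ltnW mk)) (ltW (ti m mk)).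
Qed.

Lemma sum_increment (k k1 : nat) (t : nat -> R) w : (k <= k1)%N ->
  \col_i (\sum_(l < k1 | (l < k)%N) increment (t l) (t l.+1) i w) =
  B (t k) w - B (t 0%N) w.
Proof.
move=> kk; apply/colP => i; rewrite mxE.
rewrite -(big_ord_widen k1 (fun l => increment (t l) (t l.+1) i w) kk).
rewrite -(big_mkord xpredT (fun l => increment (t l) (t l.+1) i w)).
rewrite (eq_bigr (fun l => B (t l.+1) w i 0 - B (t l) w i 0)) => [|l _].
  by rewrite telescope_sumr // !mxE.
by rewrite /increment !mxE.
Qed.

Lemma measurable_increment (s t : R) i : random_process B -> 0 <= s -> 0 <= t ->
  measurable_fun setT (increment s t i).
Proof.
move=> mB s0 t0; rewrite /increment.
under eq_fun do rewrite !mxE.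
by apply: measurable_funB; apply: mB.
Qed.

Lemma brownian_rect (P : probability Omega R) (k : nat) (t : nat -> R)
    (A : 'I_k -> 'I_n -> set R) :
  brownian_motion P B -> 0 <= t 0%N ->
  (forall l, (l < k)%N -> t l < t l.+1) ->
  (forall l i, measurable (A l i)) ->
  P [set w | forall l i, A l i (increment (t l) (t l.+1) i w)] =
  (\prod_(l < k) \prod_(i < n)
     normal_prob 0 (Num.sqrt (t l.+1 - t l)) (A l i))%E.
Proof.
move=> [_ _ _ Bn Bi] t0 ti mA.
have tge0 l : (l < k)%N -> 0 <= t l.
  by move=> lk; apply: le_trans t0 _; apply: (increasing_times ti) => //; apply: ltnW.
transitivity (\prod_(li : 'I_k * 'I_n)
    P (increment (t li.1) (t li.1.+1) li.2 @^-1` A li.1 li.2))%E.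
  have := Bi k t t0 ti (fun li => A li.1 li.2) (fun li => mA li.1 li.2).
  move=> <-; congr (P _); apply/seteqP; split => w /= h; last by move=> l i; apply: (h (l, i)).
  by move=> [l i]; apply: h.
rewrite pair_big /=; apply: eq_bigr => -[l i] _ /=.
exact: (Bn _ _ (tge0 _ (ltn_ord l)) (ti _ (ltn_ord l)) i _ (mA l i)).
Qed.

Definition concat_times (k1 : nat) (t t' : nat -> R) (l : nat) : R :=
  if (l <= k1)%N then t l else t k1 + t' (l - k1)%N.

Lemma concat_timesL k1 t t' l : (l <= k1)%N -> concat_times k1 t t' l = t l.
Proof. by rewrite /concat_times => ->. Qed.

Lemma concat_timesR k1 t t' l : t' 0%N = 0 ->
  concat_times k1 t t' (k1 + l) = t k1 + t' l.
Proof.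
move=> t'0; rewrite /concat_times; case: l => [|l].
  by rewrite addn0 leqnn t'0 addr0.
by rewrite addnS ltnNge leq_addr /= -addnS addKn.
Qed.

Lemma concat_times_lt k1 k2 t t' : t' 0%N = 0 ->
  (forall l, (l < k1)%N -> t l < t l.+1) ->
  (forall l, (l < k2)%N -> t' l < t' l.+1) ->
  forall l, (l < k1 + k2)%N -> concat_times k1 t t' l < concat_times k1 t t' l.+1.
Proof.
move=> t'0 ti t'i l lk; have [h|h] := ltnP l k1.
  by rewrite !concat_timesL ?(ltnW h) //; apply: ti.
rewrite -(subnKC h) -addnS !concat_timesR // ltrD2l; apply: t'i.
by rewrite ltn_subLR.
Qed.

Section IndependentIncrements.
Variables (P P' : probability Omega R) (k1 k2 : nat) (t t' : nat -> R).
Hypothesis hB : brownian_motion P B.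
Hypothesis hB' : brownian_motion P' B.
Hypothesis t0 : t 0%N = 0.
Hypothesis t'0 : t' 0%N = 0.
Hypothesis ti : forall l, (l < k1)%N -> t l < t l.+1.
Hypothesis t'i : forall l, (l < k2)%N -> t' l < t' l.+1.

Let J : finType := ('I_k1 * 'I_n + 'I_k2 * 'I_n)%type.

Let U (li : 'I_k1 * 'I_n) : Omega -> R :=
  increment (t li.1) (t li.1.+1) li.2.
Let V (li : 'I_k2 * 'I_n) : Omega -> R :=
  increment (t k1 + t' li.1) (t k1 + t' li.1.+1) li.2.
Let V' (li : 'I_k2 * 'I_n) : Omega -> R :=
  increment (t' li.1) (t' li.1.+1) li.2.

Let Y1 (j : J) (w : Omega) : R :=
  match j with inl li => U li w | inr li => V li w end.
Let Y2 (j : J) (w : Omega * Omega) : R :=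
  match j with inl li => U li w.1 | inr li => V' li w.2 end.

Let tge0 l : (l <= k1)%N -> 0 <= t l.
Proof.
by move=> lk; rewrite -t0; apply: (increasing_times ti).
Qed.

Let t'ge0 l : (l <= k2)%N -> 0 <= t' l.
Proof.
by move=> lk; rewrite -t'0; apply: (increasing_times t'i).
Qed.

Let mB : random_process B. Proof. by have [] := hB. Qed.

Let mU li : measurable_fun setT (U li).
Proof.
by apply: measurable_increment => //; apply: tge0 => //; apply: ltnW.
Qed.

Let mV li : measurable_fun setT (V li).
Proof.
apply: measurable_increment => //; apply: addr_ge0; rewrite ?tge0 ?t'ge0 //.
exact: ltnW.
Qed.

Let mV' li : measurable_fun setT (V' li).
Proof.
by apply: measurable_increment => //; apply: t'ge0 => //; apply: ltnW.
Qed.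

Let mY1 j : measurable_fun setT (Y1 j).
Proof. by case: j => li; [exact: mU|exact: mV]. Qed.

Let mY2 j : measurable_fun setT (Y2 j).
Proof.
case: j => li.
  exact: (measurableT_comp (mU li) measurable_fst).
exact: (measurableT_comp (mV' li) measurable_snd).
Qed.

(** Under [P], the increments [U] before [t k1] and [V] after it have the same
    joint law as [U] and [V'] have under the product of [P] and [P']: on
    rectangles both sides are the same product of normal probabilities. *)
Let rect_eq A : (forall j, measurable (A j)) ->
  P [set w | rect A (Y1 ^~ w)] = (P \x P')%E [set w | rect A (Y2 ^~ w)].
Proof.
move=> mA.
pose A1 (l : 'I_k1) i := A (inl (l, i)).
pose A2 (l : 'I_k2) i := A (inr (l, i)).
pose A12 (l : 'I_(k1 + k2)) i :=
  match fintype.split l with inl l1 => A1 l1 i | inr l2 => A2 l2 i end.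
have mA1 l i : measurable (A1 l i) by apply: mA.
have mA2 l i : measurable (A2 l i) by apply: mA.
have mA12 l i : measurable (A12 l i) by rewrite /A12; case: (fintype.split l).
have tau0 : 0 <= concat_times k1 t t' 0 by rewrite concat_timesL // t0.
have E := brownian_rect hB tau0 (concat_times_lt t'0 ti t'i) mA12.
have E1 := brownian_rect hB (eq_ind_r (fun x => 0 <= x) (lexx 0) t0) ti mA1.
have E2 := brownian_rect hB' (eq_ind_r (fun x => 0 <= x) (lexx 0) t'0) t'i mA2.
have A12l l i : A12 (lshift k2 l) i = A1 l i.
  by rewrite /A12 -[lshift _ _]/(unsplit (inl l)) unsplitK.
have A12r l i : A12 (rshift k1 l) i = A2 l i.
  by rewrite /A12 -[rshift _ _]/(unsplit (inr l)) unsplitK.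
have tl (l : 'I_k1) : concat_times k1 t t' (lshift k2 l) = t l.
  by rewrite concat_timesL //=; apply: ltnW.
have tlS (l : 'I_k1) : concat_times k1 t t' (lshift k2 l).+1 = t l.+1.
  by rewrite concat_timesL //=; apply: ltn_ord.
have tr (l : 'I_k2) : concat_times k1 t t' (rshift k1 l) = t k1 + t' l.
  by rewrite concat_timesR.
have trS (l : 'I_k2) : concat_times k1 t t' (rshift k1 l).+1 = t k1 + t' l.+1.
  by rewrite -addnS concat_timesR.
transitivity (P [set w | forall l i, A12 l i (increment
    (concat_times k1 t t' l) (concat_times k1 t t' l.+1) i w)]).
  congr (P _); apply/seteqP; split => w /= h.
    move=> l i; rewrite -(splitK l); case: (fintype.split l) => l' /=.
      by rewrite A12l tl tlS; apply: (h (inl (l', i))).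
    by rewrite A12r tr trS; apply: (h (inr (l', i))).
  move=> [[l i]|[l i]] /=.
    by have := h (lshift k2 l) i; rewrite A12l tl tlS.
  by have := h (rshift k1 l) i; rewrite A12r tr trS.
pose S1 := [set w | forall l i, A1 l i (increment (t l) (t l.+1) i w)].
pose S2 := [set w | forall l i, A2 l i (increment (t' l) (t' l.+1) i w)].
have mS1 : measurable S1.
  have -> : S1 = \bigcap_(li : 'I_k1 * 'I_n) (U li @^-1` A1 li.1 li.2).
    apply/seteqP; split => w h; first by move=> [l i] _; apply: h.
    by move=> l i; apply: (h (l, i)).
  apply: fin_bigcap_measurable => // li _.
  by rewrite -[X in measurable X]setTI; apply: mU.
have mS2 : measurable S2.
  have -> : S2 = \bigcap_(li : 'I_k2 * 'I_n) (V' li @^-1` A2 li.1 li.2).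
    apply/seteqP; split => w h; first by move=> [l i] _; apply: h.
    by move=> l i; apply: (h (l, i)).
  apply: fin_bigcap_measurable => // li _.
  by rewrite -[X in measurable X]setTI; apply: mV'.
transitivity (P S1 * P' S2)%E.
  apply: (etrans E); apply/esym; apply: (etrans (congr2 mule E1 E2)); apply/esym.
  rewrite big_split_ord.
  apply: congr2.
    by apply: eq_bigr => l _; apply: eq_bigr => i _; rewrite A12l tl tlS.
  apply: eq_bigr => l _; apply: eq_bigr => i _.
  by rewrite A12r tr trS opprD addrACA subrr add0r.
transitivity ((P \x P')%E (S1 `*` S2)).
  by apply/esym; apply: product_measure1E.
congr ((P \x P')%E _); apply/seteqP; split => -[w1 w2] /=.
  by move=> [h1 h2] [[l i]|[l i]]; [exact: h1|exact: h2].
by move=> h; split => l i; [apply: (h (inl (l, i)))|apply: (h (inr (l, i)))].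
Qed.

Variables (sigma : 'M[R]_n) (h1 h2 : nat -> 'cV[R]_n) (e : R).

(** The constraint of a tube at one time of a grid, read on the increments. *)
Let path_ball (I : finType) (inj : I * 'I_n -> J) (p : I -> nat) (h : nat -> 'cV[R]_n)
    (k : nat) : set (g_sigma_algebraType (@rects R J)) :=
  [set y | enorm (sigma *m (\col_i \sum_(l | (p l < k)%N) y (inj (l, i))) - h k) <= e].

Let measurable_path_ball (I : finType) (inj : I * 'I_n -> J) p h k :
  measurable (path_ball inj p h k).
Proof.
apply: measurable_enorm_le; apply: measurable_mulmx_sub => j.
apply: (@eq_measurable_fun _ _ _ _ _
  (fun y : g_sigma_algebraType (@rects R J) =>
     \sum_l if (p l < k)%N then y (inj (l, j)) else 0)) => [y _|].
  by rewrite mxE [in RHS]big_mkcond.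
by apply: measurable_sum => l; case: (p l < k)%N; [exact: measurable_proj|exact: measurable_cst].
Qed.

(** This single identity contains the independence of the increments after
    [t k1] from the past, and the fact that their law depends neither on the time
    shift nor on the probability chosen among [P] and [P']. *)
Lemma increments_indep :
  P ([set w | forall k, (k <= k1)%N ->
        enorm (sigma *m (B (t k) w - B 0 w) - h1 k) <= e] `&`
     [set w | forall k, (k <= k2)%N ->
        enorm (sigma *m (B (t k1 + t' k) w - B (t k1) w) - h2 k) <= e]) =
  (P [set w | forall k, (k <= k1)%N ->
        (enorm (sigma *m (B (t k) w - B 0 w) - h1 k) <= e)%R] *
   P' [set w | forall k, (k <= k2)%N ->
        (enorm (sigma *m (B (t' k) w - B 0 w) - h2 k) <= e)%R])%E.
Proof.
pose S1 : set (g_sigma_algebraType (@rects R J)) :=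
  \bigcap_(k in `I_k1.+1) path_ball (@inl _ _) (@nat_of_ord k1) h1 k.
pose S2 : set (g_sigma_algebraType (@rects R J)) :=
  \bigcap_(k in `I_k2.+1) path_ball (@inr _ _) (@nat_of_ord k2) h2 k.
have mS1 : measurable S1 by apply: bigcap_measurableType => k _.
have mS2 : measurable S2 by apply: bigcap_measurableType => k _.
have := eq_joint_law (P2 := (P \x P')%E) mY1 mY2 rect_eq (measurableI _ _ mS1 mS2).
have E1 w k : (k <= k1)%N -> path_ball (@inl _ _) (@nat_of_ord k1) h1 k (Y1 ^~ w) =
    (enorm (sigma *m (B (t k) w - B 0 w) - h1 k) <= e).
  by move=> kk; rewrite /path_ball /= -[in B 0 w]t0 -(sum_increment t w kk).
have E2 w k : (k <= k1)%N -> path_ball (@inl _ _) (@nat_of_ord k1) h1 k (Y2 ^~ w) =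
    (enorm (sigma *m (B (t k) w.1 - B 0 w.1) - h1 k) <= e).
  by move=> kk; rewrite /path_ball /= -[in B 0 _]t0 -(sum_increment t w.1 kk).
have E3 w k : (k <= k2)%N -> path_ball (@inr _ _) (@nat_of_ord k2) h2 k (Y1 ^~ w) =
    (enorm (sigma *m (B (t k1 + t' k) w - B (t k1) w) - h2 k) <= e).
  move=> kk; have := sum_increment (fun l => t k1 + t' l) w kk.
  by rewrite t'0 addr0 => <-.
have E4 w k : (k <= k2)%N -> path_ball (@inr _ _) (@nat_of_ord k2) h2 k (Y2 ^~ w) =
    (enorm (sigma *m (B (t' k) w.2 - B 0 w.2) - h2 k) <= e).
  by move=> kk; rewrite /path_ball /= -[in B 0 _]t'0 -(sum_increment t' w.2 kk).
set F1 := [set w | forall k, (k <= k1)%N ->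
        (enorm (sigma *m (B (t k) w - B 0 w) - h1 k) <= e)%R].
set F2 := [set w | forall k, (k <= k2)%N ->
        (enorm (sigma *m (B (t' k) w - B 0 w) - h2 k) <= e)%R].
have mF1 : measurable F1.
  have -> : F1 = \bigcap_(k in `I_k1.+1)
      [set w | enorm (sigma *m (B (t k) w - B 0 w) - h1 k) <= e].
    by apply/seteqP; split.
  apply: bigcap_measurableType => k kk; apply: measurable_enorm_le.
  by apply: measurable_mulmx_sub => i; apply: measurable_increment => //; apply: tge0.
have mF2 : measurable F2.
  have -> : F2 = \bigcap_(k in `I_k2.+1)
      [set w | enorm (sigma *m (B (t' k) w - B 0 w) - h2 k) <= e].
    by apply/seteqP; split.
  apply: bigcap_measurableType => k kk; apply: measurable_enorm_le.
  by apply: measurable_mulmx_sub => i; apply: measurable_increment => //; apply: t'ge0.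
move=> E; transitivity ((P \x P')%E (F1 `*` F2)); last exact: product_measure1E.
transitivity (P [set w | (S1 `&` S2) (Y1 ^~ w)]).
  congr (P _); apply/seteqP; split => w [h h'].
    by split => k kk; [rewrite E1 //; apply: h|rewrite E3 //; apply: h'].
  by split => k kk; [rewrite -E1 //; apply: h|rewrite -E3 //; apply: h'].
rewrite E; congr ((P \x P')%E _); apply/seteqP; split => w [h h'].
  by split => k kk; [rewrite -E2 //; apply: h|rewrite -E4 //; apply: h'].
by split => k kk; [rewrite E2 //; apply: h|rewrite E4 //; apply: h'].
Qed.
End IndependentIncrements.

End BrownianIncrements.

(** * Concatenation of tubes *)

Section TubeConcatenation.
Context {R : realType} {d : measure_display} {Omega : measurableType d} {n : nat}.
Variables (B : R -> Omega -> 'cV[R]_n) (sigma : 'M[R]_n).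

Definition noise_from (c t : R) (w : Omega) : 'cV[R]_n :=
  sigma *m (B (c + t) w - B c w).

Lemma process_noise_from (c T : R) : random_process B -> continuous_paths B ->
  0 <= c -> process_on 0 T (noise_from c).
Proof.
move=> mB cB c0; split => [t /andP[t0 _] i|w].
  apply: (@eq_measurable_fun _ _ _ _ _
    (fun w => (sigma *m (B (c + t) w - B c w) - 0) i 0)).
    by move=> w _; rewrite subr0.
  apply: measurable_mulmx_sub => j; apply: measurable_increment => //.
  exact: addr_ge0.
apply: within_continuous_mulmx; apply: within_continuousB; last first.
  by move=> x; apply: cvg_cst.
apply: (within_continuous_shift (f := fun t => B t w)).
apply: continuous_subspaceW (cB w) => t.
rewrite /= !in_itv /= addr0 andbT => /andP[ct _]; exact: le_trans c0 ct.
Qed.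

Variables (P P' : probability Omega R).
Hypothesis hB : brownian_motion P B.
Hypothesis hB' : brownian_motion P' B.

(** On the grids the probability is a product, bounded below by the product of the
    probabilities of the two tubes; the events on the grids decrease to the
    intersection of the tubes. *)
Lemma tube_concat (del S e : R) (h1 h2 : R -> 'cV[R]_n) :
  0 < del -> 0 < S ->
  {within `[0, del], continuous h1} -> {within `[0, S], continuous h2} ->
  (0 < P (tube 0 del e (fun t w => (noise_from 0 t w - h1 t)%R)))%E ->
  (0 < P' (tube 0 S e (fun t w => (noise_from 0 t w - h2 t)%R)))%E ->
  (0 < P (tube 0 del e (fun t w => (noise_from 0 t w - h1 t)%R) `&`
          tube 0 S e (fun t w => (noise_from del t w - h2 t)%R)))%E.
Proof.
move=> del0 S0 h1c h2c.
have [mB cB _ _ _] := hB.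
have Z1 : process_on 0 del (fun t w => noise_from 0 t w - h1 t).
  exact: (process_on_sub (process_noise_from del mB cB (lexx 0)) h1c).
have Z2' : process_on 0 S (fun t w => noise_from 0 t w - h2 t).
  exact: (process_on_sub (process_noise_from S mB cB (lexx 0)) h2c).
have Z2 : process_on 0 S (fun t w => noise_from del t w - h2 t).
  exact: (process_on_sub (process_noise_from S mB cB (ltW del0)) h2c).
have [del0' S0'] := (ltW del0, ltW S0).
set E1 := tube 0 del e _; set E2' := tube 0 S e (fun t w => noise_from 0 t w - h2 t).
move=> p1 p2.
rewrite (tubeE _ S0' Z2) /E1 (tubeE _ del0' Z1).
pose G1 := grid_tube 0 del e (fun t w => noise_from 0 t w - h1 t).
pose G2 := grid_tube 0 S e (fun t w => noise_from del t w - h2 t).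
pose G2' := grid_tube 0 S e (fun t w => noise_from 0 t w - h2 t).
have mG1 N : measurable (G1 N) by apply: measurable_grid_tube.
have mG2 N : measurable (G2 N) by apply: measurable_grid_tube.
have mG2' N : measurable (G2' N) by apply: measurable_grid_tube.
have PG N : P (G1 N `&` G2 N) = (P (G1 N) * P' (G2' N))%E.
  have -> : G1 N = [set w | forall k, (k <= 2 ^ N)%N -> enorm (sigma *m
      (B (grid 0 del N k) w - B 0 w) - h1 (grid 0 del N k)) <= e].
    by apply/seteqP; split => w h k kN; have := h k kN; rewrite /noise_from add0r.
  have -> : G2' N = [set w | forall k, (k <= 2 ^ N)%N -> enorm (sigma *m
      (B (grid 0 S N k) w - B 0 w) - h2 (grid 0 S N k)) <= e].
    by apply/seteqP; split => w h k kN; have := h k kN; rewrite /noise_from add0r.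
  have -> : G2 N = [set w | forall k, (k <= 2 ^ N)%N -> enorm (sigma *m
      (B (grid 0 del N (2 ^ N) + grid 0 S N k) w - B (grid 0 del N (2 ^ N)) w) -
      h2 (grid 0 S N k)) <= e].
    by rewrite grid_last.
  apply: (increments_indep hB hB' (grid0 0 del N) (grid0 0 S N)
    (fun l _ => grid_lt N del0 (ltnSn l)) (fun l _ => grid_lt N S0 (ltnSn l))
    sigma (fun k => h1 (grid 0 del N k)) (fun k => h2 (grid 0 S N k)) e).
have c0 : (0 < P E1 * P' E2')%E by apply: mule_gt0.
apply: (lt_le_trans c0).
have GE : (\bigcap_N G1 N) `&` (\bigcap_N G2 N) = \bigcap_N (G1 N `&` G2 N).
  by rewrite bigcapI.
rewrite -[X in P (X `&` _)]/(\bigcap_N G1 N) -[X in P (_ `&` X)]/(\bigcap_N G2 N) GE.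
have cv : P (G1 N `&` G2 N) @[N --> \oo] --> P (\bigcap_N (G1 N `&` G2 N)).
  apply: nonincreasing_cvg_mu.
  - apply: le_lt_trans (probability_le1 _ _) _; last exact: ltry.
    exact: measurableI.
  - by move=> N; apply: measurableI.
  - by apply: bigcap_measurableType => N _; apply: measurableI.
  - move=> M N MN; apply/subsetPset; apply: setISS; apply/subsetPset.
      exact: grid_tube_nincr.
    exact: grid_tube_nincr.
rewrite -(cvg_lim _ cv) //; apply: lime_ge; first by apply/cvg_ex; eexists; exact: cv.
near=> N; rewrite PG; apply: lee_pmul => //.
  apply: le_measure; rewrite ?inE //; first exact: measurable_tube.
  by rewrite /E1 (tubeE _ del0' Z1); apply: bigcap_inf.
apply: le_measure; rewrite ?inE //; first exact: measurable_tube.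
by rewrite /E2' (tubeE _ S0' Z2'); apply: bigcap_inf.
Unshelve. all: by end_near. Qed.

End TubeConcatenation.

(** * Means of order p *)

Section Moments.
Context {R : realType} {d : measure_display} {T : measurableType d}.
Variable P : probability T R.
Local Open Scope ereal_scope.

Definition lp_mean (f : T -> R) (p : R) : \bar R :=
  'E_P[fun w => (f w `^ p)%R] `^ p^-1.

Let measurable_powR (f : T -> R) p : measurable_fun setT f ->
  measurable_fun setT (fun x => (f x `^ p)%R).
Proof. exact: (@measurableT_comp _ _ _ _ _ _ (@powR R ^~ p)). Qed.

Lemma lp_meanE (f : T -> R) (p : R) :
  lp_mean f p = (\int[P]_w (f w `^ p)%:E) `^ p^-1.
Proof. by rewrite /lp_mean unlock. Qed.

(** Lyapunov's inequality: Hoelder's inequality for [f `^ p] and [1]. *)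
Lemma lp_mean_ndecr (f : T -> R) (p q : R) : measurable_fun setT f ->
  (forall w, (0 <= f w)%R) -> (0 < p)%R -> (p <= q)%R ->
  lp_mean f p <= lp_mean f q.
Proof.
move=> mf f0 p0; rewrite le_eqVlt => /orP[/eqP -> //|pq].
have q0 : (0 < q)%R by apply: lt_trans pq.
pose r := (q / p)%R; pose r' := ((1 - r^-1)^-1)%R.
have r0 : (0 < r)%R by rewrite divr_gt0.
have ri1 : (r^-1 < 1)%R by rewrite invf_lt1 // ltr_pdivlMr // mul1r.
have r'0 : (0 < r')%R by rewrite invr_gt0 subr_gt0.
have rr' : (r^-1 + r'^-1 = 1)%R by rewrite invrK subrKC.
pose g w := (f w `^ p)%R.
have g0 w : (0 <= g w)%R by apply: powR_ge0.
have mg : measurable_fun setT g by apply: measurable_powR.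
have m1 : measurable_fun [set: T] (@cst T R 1%R) by exact: measurable_cst.
have := hoelder P mg m1 r0 r'0 rr'.
have -> : Lnorm P r'%:E (EFin \o @cst T R 1%R) = 1.
  rewrite -[LHS]/(Lnorm P r'%:E (cst 1)) Lnorm_cst1.
  by rewrite [X in X `^ _](_ : _ = 1) ?poweR1r //; exact: probability_setT.
rewrite mule1.
rewrite unlock /Lnorm invr1 poweRe1; last first.
  by apply: integral_ge0 => w _; apply: poweR_ge0.
rewrite (eq_integral (fun w => (f w `^ p)%:E)); last first.
  by move=> w _; rewrite /= mulr1 powRr1 // ger0_norm.
rewrite [X in _ <= X `^ _ -> _](eq_integral (fun w => (f w `^ q)%:E)); last first.
  by move=> w _; rewrite /= ger0_norm // /g -powRrM /r mulrC divfK ?gt_eqF.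
move=> h; rewrite !lp_meanE.
apply: (@le_trans _ _ ((\int[P]_w (f w `^ q)%:E) `^ r^-1 `^ p^-1)).
  apply: gt0_ler_poweR h; first by rewrite invr_ge0 ltW.
  - by rewrite in_itv /= leey andbT; apply: integral_ge0 => w _; rewrite lee_fin powR_ge0.
  - by rewrite in_itv /= leey andbT; apply: poweR_ge0.
by rewrite -poweRrM /r invf_div mulrAC divff ?mul1r // gt_eqF.
Qed.

Lemma lp_mean_ge (f : T -> R) (p c : R) (E : set T) : measurable_fun setT f ->
  (forall w, (0 <= f w)%R) -> (0 < p)%R -> measurable E -> (0 <= c)%R ->
  (forall w, E w -> (c <= f w)%R) ->
  (c * fine (P E) `^ p^-1)%:E <= lp_mean f p.
Proof.
move=> mf f0 p0 mE c0 hE.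
have PEfin : P E \is a fin_num by apply: fin_num_measure.
have -> : (c * fine (P E) `^ p^-1)%:E = ((c `^ p)%:E * P E) `^ p^-1.
  rewrite poweRM ?lee_fin ?powR_ge0 // poweR_EFin -powRrM divff ?gt_eqF //.
  by rewrite powRr1 // -{2}(fineK PEfin) poweR_EFin EFinM.
rewrite lp_meanE.
apply: gt0_ler_poweR; first by rewrite invr_ge0 ltW.
- by rewrite in_itv /= leey andbT mule_ge0 ?lee_fin ?powR_ge0.
- rewrite in_itv /= leey andbT; apply: integral_ge0 => w _.
  by rewrite lee_fin powR_ge0.
rewrite -(integral_cst P mE).
apply: (@le_trans _ _ (\int[P]_(w in E) (f w `^ p)%:E)).
  apply: ge0_le_integral => //.
  - by move=> w _; rewrite lee_fin powR_ge0.
  - apply/measurable_EFinP; apply: measurable_funTS; exact: measurable_powR.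
  - move=> w Ew; rewrite lee_fin ge0_ler_powR ?(ltW p0) ?nnegrE //; exact: hE.
apply: ge0_subset_integral => //.
- by apply/measurable_EFinP; apply: measurable_powR.
- by move=> w _; rewrite lee_fin powR_ge0.
Qed.

End Moments.

(** * Limits as p tends to infinity *)

Section LimitAtInfinity.
Context {R : realType}.

(** As [q `^ p^-1] is the exponential of [ln q / p], it is at least
    [1 + ln q / p]. *)
Lemma cst_powR_inv_ge (c q eps : R) : (0 <= c) -> (0 < q) -> (0 < eps) ->
  exists2 p : R, (1 <= p) & (c - eps <= c * q `^ p^-1).
Proof.
move=> c0 q0 eps0.
pose A := (c * `|ln q|).
have A0 : (0 <= A) by rewrite mulr_ge0.
exists (1 + A / eps); first by rewrite lerDl divr_ge0 // ltW.
set p := (1 + A / eps).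
have p0 : (0 < p) by rewrite ltr_pwDl // divr_ge0 // ltW.
have qE : q `^ p^-1 = expR (p^-1 * ln q) by rewrite /powR gt_eqF.
have h : (1 - p^-1 * `|ln q| <= q `^ p^-1).
  rewrite qE; apply: le_trans (expR_ge1Dx _); rewrite lerD2l -mulrN.
  apply: ler_wpM2l; first by rewrite invr_ge0 ltW.
  by rewrite lerNl -normrN ler_norm.
apply: (@le_trans _ _ (c * (1 - p^-1 * `|ln q|))); last exact: ler_wpM2l.
rewrite mulrBr mulr1 lerD2l lerN2 mulrCA -/A mulrC ler_pdivrMr //.
by rewrite /p mulrDr mulr1 mulrCA divff ?gt_eqF // mulr1 lerDr ltW.
Qed.

Local Open Scope ereal_scope.

Lemma ndecr_cvg_pinfty (F : R -> \bar R) :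
  (forall p q, (1 <= p)%R -> (p <= q)%R -> F p <= F q) ->
  cvg (F p @[p --> +oo%R]) /\
  (forall p, (1 <= p)%R -> F p <= lim (F p @[p --> +oo%R])).
Proof.
move=> Fnd; pose G p := F (Num.max 1%R p).
have Gnd : nondecreasing_fun G.
  move=> p q pq; apply: Fnd; first by rewrite le_max lexx.
  by rewrite ge_max !le_max lexx pq orbT.
have cvF : F p @[p --> +oo%R] --> ereal_sup (range G).
  apply: cvg_trans (nondecreasing_cvge Gnd).
  apply: near_eq_cvg; near=> s.
  have s1 : (1 <= s)%R by near: s; apply: nbhs_pinfty_ge; rewrite num_real.
  by rewrite /G max_r.
split; first by apply/cvg_ex; eexists; exact: cvF.
move=> p p1; rewrite (cvg_lim _ cvF) //; apply: ereal_sup_ubound.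
by exists p => //; rewrite /G max_r.
Unshelve. all: by end_near. Qed.

End LimitAtInfinity.

(** * From the starting point to an admissible path *)

Lemma measure_ae_sub {R : realType} {d} {T : measurableType d}
    (mu : {measure set T -> \bar R}) (A C : set T) :
  measurable A -> measurable C -> {ae mu, forall w, A w -> C w} ->
  (mu A <= mu C)%E.
Proof.
move=> mA mC AC.
have AC0 : mu (A `\` C) = 0%E.
  apply/negligibleP; first exact: measurableD.
  by apply: negligibleS AC => w [Aw Cw] /(_ Aw).
apply: (@le_trans _ _ (mu (C `|` (A `\` C)))).
  apply: le_measure; rewrite ?inE //.
    by apply: measurableU => //; apply: measurableD.
  by move=> w Aw; have [Cw|nCw] := pselect (C w); [left|right].
apply: le_trans (measureU2 _ mC (measurableD mA mC)) _.
by rewrite [X in (_ + X <= _)%E]AC0 adde0.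
Qed.

Lemma positive_ae_witness {R : realType} {d} {T : measurableType d}
    (mu : {measure set T -> \bar R}) (A : set T) (Q : T -> Prop) :
  measurable A -> (0 < mu A)%E -> {ae mu, forall w, Q w} -> exists2 w, A w & Q w.
Proof.
move=> mA A0 hQ; apply: contrapT => h.
have : (mu A <= mu set0)%E.
  apply: measure_ae_sub => //; apply: filterS hQ => w Qw Aw.
  by apply: h; exists w.
by rewrite measure0 leNgt A0.
Qed.

Section Controllability.
Context {R : realType} {n : nat} (hn : (0 < n)%N).
Variables (sigma : 'M[R]_n) (b : 'cV[R]_n -> 'cV[R]_n) (L CJ : R).
Hypothesis L0 : 0 <= L.
Hypothesis hL : forall x y : 'cV[R]_n,
  dot (x - y) (b x - b y) <= L * enorm (x - y) ^+ 2.
Hypothesis hlip : forall r : R, exists2 Cb : R, 0 <= Cb &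
  forall x y, enorm x <= r -> enorm y <= r ->
    enorm (b x - b y) <= Cb * enorm (x - y).
Hypothesis CJ0 : 0 <= CJ.
Hypothesis hJ : forall x y v,
  enorm ((jac b x - jac b y) *m v) <= CJ * enorm (x - y) * enorm v.
Context {d : measure_display} {Omega : measurableType d}.
Variables (P : 'cV[R]_n -> probability Omega R) (B X : R -> Omega -> 'cV[R]_n).
Hypothesis hB : forall x, brownian_motion (P x) B.
Hypothesis hX : forall x, sde_solution (P x) b sigma B x X.
Variable Phi : R -> Omega -> 'M[R]_n.
Hypothesis hPhi : tangent_flow b X Phi.

Notation noise := (noise_from B sigma).

Lemma drift_integral0 (y : R -> 'cV[R]_n) : drift_integral b y 0 = 0.
Proof. by apply/colP => i; rewrite !mxE set_itv1 Rintegral_set1. Qed.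

Let mX : random_process X. Proof. by have [] := hX 0. Qed.
Let cX : continuous_paths X. Proof. by have [] := hX 0. Qed.
Let mB : random_process B. Proof. by have [] := hB 0. Qed.
Let cB : continuous_paths B. Proof. by have [] := hB 0. Qed.

Let pX (T : R) : process_on 0 T X.
Proof.
split=> [t /andP[t0 _] i|w]; first exact: mX.
apply: (continuous_subspaceW _ (@cX w)) => t; rewrite /= !in_itv /=.
by move=> /andP[->].
Qed.

Let ae_driven x : {ae P x, forall w,
  (forall T : R, 0 <= T -> driven b (noise 0 ^~ w) (X ^~ w) T) /\
  (X ^~ w - noise 0 ^~ w) 0 = x}.
Proof.
have [_ _ hx] := hX x; have [_ _ B0 _ _] := hB x.
apply: filterS2 hx B0 => w hx B0.
have noiseE t : noise 0 t w = sigma *m B t w by rewrite /noise_from B0 add0r subr0.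
split=> [T T0|].
  apply: (driven_of_integral hlip (x := x)) => //; first by have [_] := pX T; apply.
  by move=> t t0; rewrite noiseE; apply: hx.
rewrite !fctE noiseE (hx 0 (lexx _)) addrK.
by rewrite -[X in x + X]/(drift_integral b (X ^~ w) 0) drift_integral0 addr0.
Qed.

(** The noise that drives the equation along [gamma], normalised to vanish at 0. *)
Definition path_noise (gamma : R -> 'cV[R]_n) (t : R) : 'cV[R]_n :=
  gamma t - gamma 0 - drift_integral b gamma t.

Lemma driven_path_noise (gamma : R -> 'cV[R]_n) (T : R) : 0 <= T ->
  {within `[0, T], continuous gamma} ->
  [/\ driven b (path_noise gamma) gamma T,
      (gamma - path_noise gamma) 0 = gamma 0 &
      {within `[0, T], continuous (path_noise gamma)}].
Proof.
move=> T0 gc; split.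
- apply: (driven_of_integral hlip (x := gamma 0)) => // t _.
  by rewrite /path_noise -[X in _ + X]addrA -opprD subrKC.
- by rewrite !fctE /path_noise drift_integral0 subrr subr0 subr0.
have [Ic _] := drift_integralP hlip T0 gc.
apply: within_continuousB => //; apply: within_continuousB => //.
by move=> x; apply: cvg_cst.
Qed.

Lemma admissible_noise (gamma : R -> 'cV[R]_n) (T e : R) : 0 <= T ->
  admissible P X T gamma -> 0 < e ->
  (0 < P (gamma 0%R)
       (tube 0 T e (fun t w => (noise 0 t w - path_noise gamma t)%R)))%E.
Proof.
move=> T0 [gc adm] e0.
have [dg g0 nc] := driven_path_noise T0 gc.
have [r _ gr] := within_continuous_bounded gc.
have [del del0 hdel] := noise_close hlip T0 gr dg e0.
pose A := tube 0 T del (fun t w => X t w - gamma t).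
have mA : measurable A.
  exact: (measurable_tube _ T0 (process_on_sub (pX T) gc)).
have PA : (0 < P (gamma 0%R) A)%E.
  have := adm del del0; congr (_ < P _ _)%E; apply/seteqP; split => w h t.
    by move=> /andP[t0 tT]; apply: h.
  by move=> t0 tT; apply: h; rewrite t0.
apply: lt_le_trans PA _; apply: measure_ae_sub => //.
  have noiseP := process_noise_from sigma T mB cB (lexx 0).
  exact: (measurable_tube _ T0 (process_on_sub noiseP nc)).
apply: filterS (ae_driven (gamma 0)) => w [dw w0] Aw.
by apply: (hdel (X ^~ w) (noise 0 ^~ w) (dw T T0)) => //; rewrite w0 g0.
Qed.

Hypothesis hctrl : forall (x y : 'cV[R]_n) (t eps : R), 0 < t -> 0 < eps ->
  (0 < P x [set w | (enorm (X t w - y) <= eps)%R])%E.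
Hypothesis hcond :
  (exists K : R, forall x, opnorm (jac b x) <= K) \/
  (forall x y : 'cV[R]_n, exists2 r : R, 0 < r &
     forall t eps : R, 0 < t -> 0 < eps ->
     (0 < P x [set w | (enorm (X t w - y) <= eps)%R /\
            (forall s : R, 0 <= s -> s <= t -> enorm (X s w) <= r)%R])%E).

(** The order of the quantifiers matters: [K] is chosen before the time [t], so
    that the tangent flow over a short time is close to the identity. *)
Lemma reach_with_bounded_jacobian (x y : 'cV[R]_n) :
  exists2 K : R, 0 <= K & forall t eps : R, 0 < t -> 0 < eps ->
  exists E : set Omega, [/\ measurable E, (0 < P x E)%E &
    forall w, E w -> enorm (X t w - y) <= eps /\
      forall (s : R) v, 0 <= s <= t ->
        enorm (jac b (X s w) *m v) <= K * enorm v].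
Proof.
have mE t eps : 0 < t -> measurable [set w | enorm (X t w - y) <= eps].
  move=> t0; apply: measurable_enorm_le => i.
  have [Zm _] := process_on_sub (pX t) (fun z : R => cvg_cst y).
  by apply: Zm; rewrite ltW //=.
case: hcond => [[K hK]|hr].
  exists `|K| => // t eps t0 eps0; exists [set w | enorm (X t w - y) <= eps].
  split; [exact: mE|exact: hctrl|move=> w Ew; split => // s v _].
  apply: le_trans (enorm_mulmx_le_opnorm _ _ hn) _.
  apply: ler_wpM2r; first exact: enorm_ge0.
  exact: le_trans (hK _) (ler_norm K).
have [r r0 {}hr] := hr x y.
have [K K0 hK] := jac_bounded CJ0 hJ r.
exists K => // t eps t0 eps0.
exists ([set w | enorm (X t w - y) <= eps] `&` tube 0 t r X); split.
- by apply: measurableI; [exact: mE|apply: measurable_tube => //; exact: ltW].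
- have := hr t eps t0 eps0; congr (_ < P x _)%E; apply/seteqP; split => w [h h'].
    by split => // s /andP[s0 st]; apply: h'.
  by split => // s s0 st; apply: h'; rewrite s0.
by move=> w [h h']; split => // s v st; apply: hK; apply: h'.
Qed.

Lemma variational_mulmx (gamma : R -> 'cV[R]_n) (T : R) (Psi : R -> 'M[R]_n)
    (v : 'cV[R]_n) :
  variational b gamma T 1%:M Psi -> variational b gamma T v (fun t => Psi t *m v).
Proof.
move=> [Psi0 Psic Psid]; split; first by rewrite Psi0 mul1mx.
  apply/within_continuous_mx => i j.
  have /within_continuous_mx Pc := Psic.
  have -> : (fun t => (Psi t *m v) i j) = (fun t => \sum_k Psi t i k * v k j).
    by apply/funext => t; rewrite mxE.
  apply: within_continuous_sum => k; apply: within_continuousM => //.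
  by move=> z; apply: cvg_cst.
move=> t t0 tT; apply/is_derive_mxP => i j.
have /is_derive_mxP Pd := Psid t t0 tT.
have -> : (fun s => (Psi s *m v) i j) = \sum_k (v k j *: (fun s => Psi s i k)).
  by apply/funext => s; rewrite mxE fct_sumE; apply: eq_bigr => k _; rewrite mulrC.
have D := is_derive_sum (fun k : 'I_n => is_deriveZ (v k j) (Pd i k)).
apply: (is_derive_eq D); rewrite mulmxA mxE; apply: eq_bigr => k _.
by rewrite /GRing.scale /= mulrC.
Qed.

Lemma measurable_flow (t : R) (v : 'cV[R]_n) : 0 <= t ->
  measurable_fun setT (fun w => enorm (Phi t w *m v)).
Proof.
move=> t0; have [mPhi _] := hPhi; apply: measurable_enorm => i.
apply: (@eq_measurable_fun _ _ _ _ _ (fun w => \sum_j Phi t w i j * v j 0)).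
  by move=> w _; rewrite mxE.
apply: measurable_sum => j; apply: measurable_funM => //; exact: mPhi.
Qed.

Lemma measurable_flow_ge (t c : R) (v : 'cV[R]_n) : 0 <= t ->
  measurable [set w | c <= enorm (Phi t w *m v)].
Proof.
move=> t0; have mf := measurable_flow v t0.
have -> : [set w | c <= enorm (Phi t w *m v)] =
    setT `&` (fun w => enorm (Phi t w *m v)) @^-1` [set` `[c, +oo[].
  by rewrite setTI; apply/seteqP; split => w /=; rewrite in_itv /= andbT.
by apply: mf => //; exact: measurable_itv.
Qed.

(** The process first travels to the vicinity of [gamma 0] in a time [del] so
    short that the tangent flow stays near the identity, then follows [gamma]
    with a delay [del]. Being late costs little, since [U] is continuous at
    [T]. *)
Lemma flow_large_with_positive_probability (x : 'cV[R]_n) (T eta : R)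
    (gamma : R -> 'cV[R]_n) (Psi : R -> 'M[R]_n) (v : 'cV[R]_n) : 0 < T ->
  admissible P X T gamma -> variational b gamma T 1%:M Psi -> 0 < eta ->
  (0 < P x [set w | (enorm (Psi T *m v) - eta <= enorm (Phi T w *m v))%R])%E.
Proof.
move=> T0 adm varPsi eta0; have [gc _] := adm.
have T0' := ltW T0.
have [dg g0 nc] := driven_path_noise T0' gc.
have [r _ gr] := within_continuous_bounded gc.
pose U t := Psi t *m v.
have varU : variational b gamma T v U by apply: variational_mulmx.
have e3 : 0 < eta / 3 by rewrite divr_gt0.
have [d1 d10 hd1] := flow_close CJ0 hJ T0' gr varU e3.
have [K K0 hK] := reach_with_bounded_jacobian x (gamma 0).
have K10 : 0 <= K + 1 by rewrite addr_ge0.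
have [d2 d20 hd2] := flow_short b v K10 d10.
have [rho rho0 hrho] : exists2 rho : R, 0 < rho &
    forall s, 0 <= s <= T -> `|T - s| < rho -> enorm (U s - U T) <= eta / 3.
  have [_ Uc _] := varU.
  have /within_continuous_enorm /within_continuousP gU :
      {within `[0, T], continuous (fun s => U s - U T)}.
    by apply: within_continuousB => // z; apply: cvg_cst.
  have TT : [set` `[0, T]] T by rewrite /= in_itv /= T0' lexx.
  have [rho rho0 hrho] := gU T TT _ e3; exists rho => // s sT Ts.
  have := hrho s sT Ts; rewrite subrr enorm0 sub0r normrN => h.
  exact: le_trans (ler_norm _) (ltW h).
(* [d2] controls the tangent flow until [del], and [rho] the delay *)
pose del := Num.min d2 (Num.min (rho / 2) (T / 2)).
have del0 : 0 < del by rewrite !lt_min d20 !divr_gt0.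
have del0' := ltW del0.
have deld2 : del <= d2 by rewrite ge_min lexx.
have delrho : del <= rho / 2 by rewrite !ge_min lexx orbT.
have delT : del <= T / 2 by rewrite !ge_min lexx !orbT.
pose S := T - del.
have S0 : 0 < S by rewrite /S; lra.
have S0' := ltW S0.
have ST : S <= T by rewrite /S; lra.
have TE : T = del + S by rewrite /S addrCA subrr addr0.
have gcS : {within `[0, S], continuous gamma}.
  apply: (continuous_subspaceW _ gc) => t; rewrite /= !in_itv /=.
  by move=> /andP[-> h]; apply: le_trans h ST.
have grS (t : R) : 0 <= t <= S -> enorm (gamma t) <= r.
  by move=> /andP[t0 tS]; apply: gr; rewrite t0 (le_trans tS).
have [d3 d30 hd3] := path_close L0 hL hlip S0' grS (driven_le ST dg) d10.
have [E [mE PE hE]] := hK del (d3 / 2) del0 (divr_gt0 d30 (ltr0n _ 2)).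
have noiseP := process_noise_from sigma del mB cB (lexx 0).
have both : {ae P x, forall w,
    (forall e : R, 0 < e ->
      (0 < P x (tube 0%R del e (fun t w' => (noise 0 t w' - noise 0 t w)%R)))%E) /\
    ((forall T : R, 0 <= T -> driven b (noise 0 ^~ w) (X ^~ w) T) /\
     (X ^~ w - noise 0 ^~ w) 0 = x)}.
  by apply: filterS2 (ae_tube_gt0 (P x) del0' noiseP) (ae_driven x) => w h1 h2.
(* [w0] provides the noise to be followed until [del] *)
have [w0 Ew0 [hw0 [dw0 iw0]]] := positive_ae_witness mE PE both.
have [h0y h0J] := hE w0 Ew0.
have [_ Xc] := pX del.
have [r0 _ X0r] := within_continuous_bounded (Xc w0).
have [e4 e40 [_ e4c]] := @small_factor R CJ 1 CJ0 ltr01.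
have e4d3 : 0 < Num.min e4 (d3 / 2) by rewrite lt_min e40 divr_gt0.
have [d4 d40 hd4] := path_close L0 hL hlip del0' X0r (dw0 del del0') e4d3.
pose e := Num.min d3 d4.
have e0 : 0 < e by rewrite lt_min d30.
have [ed3 ed4] : e <= d3 /\ e <= d4 by rewrite !ge_min !lexx orbT.
have [_ noisec] := noiseP.
have noiseSP := process_noise_from sigma S mB cB (lexx 0).
have noiseTP := process_noise_from sigma T mB cB (lexx 0).
have noisedSP := process_noise_from sigma S mB cB del0'.
have [_ _ ncS] := driven_path_noise S0' gcS.
have p2 : (0 < P (gamma 0%R)
    (tube 0 S e (fun t w => (noise 0 t w - path_noise gamma t)%R)))%E.
  apply: lt_le_trans (admissible_noise T0' adm e0) _; apply: le_measure.
  - by rewrite inE; exact: (measurable_tube _ T0' (process_on_sub noiseTP nc)).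
  - by rewrite inE; exact: (measurable_tube _ S0' (process_on_sub noiseSP ncS)).
  - by move=> w h t /andP[t0 tS]; apply: h; rewrite t0 (le_trans tS).
have p12 := tube_concat (hB x) (hB (gamma 0)) del0 S0 (noisec w0) ncS (hw0 e e0) p2.
apply: lt_le_trans p12 _; apply: measure_ae_sub.
- apply: measurableI.
    exact: (measurable_tube _ del0' (process_on_sub noiseP (noisec w0))).
  exact: (measurable_tube _ S0' (process_on_sub noisedSP ncS)).
- exact: measurable_flow_ge.
apply: filterS (ae_driven x) => w [dw iw] [t1 t2].
have Xw0 t : 0 <= t <= del -> enorm (X t w - X t w0) <= Num.min e4 (d3 / 2).
  apply: (hd4 (X ^~ w) (noise 0 ^~ w) (dw del del0')).
    by rewrite iw iw0 subrr enorm0 ltW.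
  by move=> s sdel; apply: le_trans (t1 s sdel) ed4.
have [_ /(_ w v T T0') varV] := hPhi.
have Vdel : enorm (Phi del w *m v - v) <= d1.
  have delT' : del <= T by rewrite -subr_ge0.
  apply: (hd2 del (X ^~ w) (fun t => Phi t w *m v) del0' deld2
    (variational_le delT' varV)) => t z tdel.
  rewrite -(subrK (jac b (X t w0)) (jac b (X t w))) mulmxDl.
  apply: le_trans (ler_enormD _ _) _; rewrite addrC mulrDl lerD //.
    exact: h0J.
  apply: le_trans (hJ _ _ _) _; apply: ler_wpM2r; first exact: enorm_ge0.
  apply: le_trans e4c; apply: ler_wpM2l => //.
  by apply: le_trans (Xw0 t tdel) _; rewrite ge_min lexx.
have Xdel : enorm (X del w - gamma 0) <= d3.
  rewrite -(subrKA (X del w0)); apply: le_trans (ler_enormD _ _) _.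
  rewrite (splitr d3) lerD //; apply: (le_trans (Xw0 del _)).
    by rewrite del0' lexx.
  by rewrite ge_min lexx orbT.
have dw' : driven b (noise 0 ^~ w) (X ^~ w) (del + S) by apply: dw; rewrite -TE.
have Xgamma (t : R) : 0 <= t <= S -> enorm (X (del + t) w - gamma t) <= d1.
  apply: (hd3 _ _ (driven_shift (noise 0 del w) del0' dw')).
    by rewrite g0 !fctE addr0 subrr subr0.
  move=> s sS; apply: le_trans ed3; have := t2 s sS.
  rewrite /noise_from -mulmxBr !add0r (_ : B (del + s) w - B 0 w - (B del w - B 0 w) =
    B (del + s) w - B del w) //.
  by rewrite opprB addrA subrK.
have varV' : variational b (X ^~ w) (del + S) v (fun t => Phi t w *m v) by rewrite -TE.
have VU : enorm (Phi T w *m v - U S) <= eta / 3.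
  rewrite TE; apply: (hd1 S _ _ _ ST (variational_shift del0' varV') Vdel Xgamma).
  by rewrite S0' lexx.
have US : enorm (U S - U T) <= eta / 3.
  apply: hrho; first by rewrite S0' ST.
  rewrite /S subKr gtr0_norm //; lra.
rewrite /=; have := ler_enorm_add_dist (U T) (Phi T w *m v).
have := ler_enormD (U T - U S) (U S - Phi T w *m v).
rewrite subrKA (enormB (U T) (U S)) (enormB (U S) (Phi T w *m v)) -[Psi T *m v]/(U T). lra.
Qed.

(** This form serves both for a fixed starting point and for the supremum over
    all of them. *)
Lemma lp_mean_flow_limit (F : R -> \bar R) (x : 'cV[R]_n) (T : R) : 0 <= T ->
  (forall p v, 1 <= p -> sphere v ->
     (lp_mean (P x) (fun w => enorm (Phi T w *m v)) p <= F p)%E) ->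
  (forall p q, 1 <= p -> p <= q -> (F p <= F q)%E) ->
  cvg (F p @[p --> +oo%R]) /\
  (kappa_infty P b X T <= lim (F p @[p --> +oo%R]))%E.
Proof.
move=> T0 FP Fnd; have [cvF Flim] := ndecr_cvg_pinfty Fnd; split => //.
apply: ub_ereal_sup => _ [gamma [Psi [adm varPsi ->]]].
apply/lee_subgt0Pr => eta eta0.
have e3 : 0 < eta / 3 by rewrite divr_gt0.
have [_ [v v1 <-] hv] := sup_adherent e3 (has_sup_opnorm (Psi T) hn).
rewrite -/(opnorm (Psi T)) in hv.
(* [lp_mean_ge] needs a nonnegative bound *)
pose c := Num.max 0 (enorm (Psi T *m v) - eta / 3).
have c0 : 0 <= c by rewrite le_max lexx.
pose E := [set w | c <= enorm (Phi T w *m v)].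
have mE : measurable E by apply: measurable_flow_ge.
have PE : (0 < P x E)%E.
  have [T0'|T0'] := ltP 0 T.
    have := flow_large_with_positive_probability x v T0' adm varPsi e3.
    congr (_ < P x _)%E; apply/seteqP; split => w /=.
      by move=> h; rewrite /E /= /c ge_max enorm_ge0.
    by rewrite /E /= /c ge_max => /andP[].
  have T00 : T = 0 by apply/eqP; rewrite eq_le T0 T0'.
  have -> : E = setT.
    apply/seteqP; split => // w _; rewrite /E /= /c ge_max enorm_ge0 /=.
    have [_ /(_ w v T T0) [Phi0 _ _]] := hPhi; have [Psi0 _ _] := varPsi.
    by rewrite T00 Phi0 Psi0 mul1mx lerBlDr lerDl ltW.
  by rewrite probability_setT lte01.
have Pfin : P x E \is a fin_num by apply: fin_num_measure.
have q0 : 0 < fine (P x E) by apply: fine_gt0; rewrite PE ltey_eq Pfin.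
have [p p1 hp] := cst_powR_inv_ge c0 q0 e3.
have p0 : 0 < p by apply: lt_le_trans p1.
apply: le_trans (Flim p p1); apply: le_trans (FP p v p1 v1).
have := lp_mean_ge (P x) (measurable_flow v T0) (fun w => enorm_ge0 _) p0 mE c0 (fun w h => h).
apply: le_trans.
rewrite -EFinB lee_fin; apply: le_trans hp.
have : enorm (Psi T *m v) - eta / 3 <= c by rewrite le_max lexx orbT.
lra.
Qed.

End Controllability.

Unset Implicit Arguments.

Theorem proposition5 (R : realType) (n : nat) (hn : (0 < n)%N)
  (sigma : 'M[R]_n) (b : 'cV[R]_n -> 'cV[R]_n)
  (hb : forall i, C2 (coord b i))
  (hb2 : exists K : R, forall i j k x,
      `|partial k (partial j (coord b i)) x| <= K)
  (hbL : exists2 L : R, 0 < L &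
      forall x y : 'cV[R]_n, dot (x - y) (b x - b y) <= L * enorm (x - y) ^+ 2)
  (d : measure_display) (Omega : measurableType d)
  (P : 'cV[R]_n -> probability Omega R)
  (B X : R -> Omega -> 'cV[R]_n)
  (hB : forall x, brownian_motion (P x) B)
  (hX : forall x, sde_solution (P x) b sigma B x X)
  (Phi : R -> Omega -> 'M[R]_n)
  (hPhi : tangent_flow b X Phi)
  (hctrl : forall (x y : 'cV[R]_n) (t eps : R), 0 < t -> 0 < eps ->
      (0 < P x [set w | (enorm (X t w - y) <= eps)%R])%E)
  (hcond :
      (exists K : R, forall x, opnorm (jac b x) <= K) \/
      (forall x y : 'cV[R]_n, exists2 r : R, 0 < r &
         forall t eps : R, 0 < t -> 0 < eps ->
         (0 < P x [set w | (enorm (X t w - y) <= eps)%R /\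
                (forall s : R, 0 <= s -> s <= t -> enorm (X s w) <= r)%R])%E)) :
  forall t : R, 0 <= t ->
    (forall x : 'cV[R]_n,
       let F (p : R) := ereal_sup [set moment (P x) Phi t p v | v in sphere] in
       cvg (F p @[p --> +oo%R]) /\
       (kappa_infty P b X t <= lim (F p @[p --> +oo%R]))%E) /\
    (cvg (kappa P Phi p t @[p --> +oo%R]) /\
     (kappa_infty P b X t <= lim (kappa P Phi p t @[p --> +oo%R]))%E).
Proof.
have [L L0 hL] := hbL; have [K hK] := hb2.
have [CJ CJ0 hJ] := jac_lipschitz hb hK.
have limP := lp_mean_flow_limit hn (ltW L0) hL (drift_lipschitz hb hK) CJ0 hJ
  hB hX hPhi hctrl hcond.
have mono (x v : 'cV[R]_n) (t p q : R) : 0 <= t -> 1 <= p -> p <= q ->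
    (moment (P x) Phi t p v <= moment (P x) Phi t q v)%E.
  move=> t0 p1 pq; apply: lp_mean_ndecr pq.
  - exact: (measurable_flow hPhi).
  - by move=> w; apply: enorm_ge0.
  - exact: lt_le_trans ltr01 p1.
move=> t t0; split=> [x F|].
  apply: (limP F x t t0) => [p v p1 v1|p q p1 pq].
    by apply: ereal_sup_ubound; exists v.
  apply: ub_ereal_sup => _ [v v1 <-]; apply: le_trans (mono x v t p q t0 p1 pq) _.
  by apply: ereal_sup_ubound; exists v.
apply: (limP (kappa P Phi ^~ t) 0 t t0) => [p v p1 v1|p q p1 pq].
  by apply: ereal_sup_ubound; exists (0, v).
apply: ub_ereal_sup => _ [[x v] xv1 <-].
apply: le_trans (mono x v t p q t0 p1 pq) _.
by apply: ereal_sup_ubound; exists (x, v).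
Qed.
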